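(* Let $\mathcal{C}$ be an abelian category, let $\mathcal{X}\subseteq\mathcal{C}$ be a class of objects, let $(\mathcal{A},\mathcal{B})$ be an $\mathcal{X}$-complete and $\mathcal{X}$-hereditary pair of classes in $\mathcal{C}$ such that $\mathcal{A}$, $\mathcal{X}$ and $\mathcal{B}$ are closed under extensions and direct summands, and let $\omega:=\mathcal{A}\cap\mathcal{B}\cap\mathcal{X}$. Then the following statements hold true. (a) $\omega=(\mathcal{A}\cap\mathcal{X})^{\perp}\cap\mathcal{A}\cap\mathcal{X}=\mathcal{A}\cap\mathcal{X}\cap\omega^{\wedge}=(\omega,\mathcal{A}\cap\mathcal{X})^{\wedge}$. Furthermore: (a1) we have that $$\mathrm{pd}_{\mathcal{X}}(\mathcal{A}\cap\mathcal{X})=\mathrm{pd}_{\mathcal{A}\cap\mathcal{X}}(\mathcal{A}\cap\mathcal{X})=\mathrm{coresdim}_{\mathcal{B}\cap\mathcal{X}}(\mathcal{A}\cap\mathcal{X})=\mathrm{coresdim}_{\mathcal{B}}^{\mathcal{X}}(\mathcal{X})=\mathrm{coresdim}_{\mathcal{B}}^{\mathcal{X}}(\mathcal{A}\cap\mathcal{X})$$ $$=\mathrm{coresdim}_{\omega}(\mathcal{A}\cap\mathcal{X})=\mathrm{coresdim}_{\mathcal{B}\cap\mathcal{X}}^{\mathcal{X}}(\mathcal{A}\cap\mathcal{X})=\mathrm{coresdim}_{\mathcal{B}\cap\mathcal{X}}^{\mathcal{X}}(\mathcal{X});$$ (a2) $\mathrm{pd}_{\mathcal{A}\cap\mathcal{X}}(\mathcal{A}\cap\mathcal{X})<\infty$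 if, and only if, $\mathcal{A}\cap\mathcal{X}\subseteq\omega^{\vee}$ and $\mathrm{pd}_{\mathcal{X}}(\omega)<\infty$. Moreover, if $\mathrm{pd}_{\mathcal{A}\cap\mathcal{X}}(\mathcal{A}\cap\mathcal{X})<\infty$, then $\mathcal{X}\subseteq(\mathcal{X},\mathcal{B})^{\vee}\subseteq(\mathcal{B}\cap\mathcal{X})^{\vee}$ and $\mathrm{pd}_{\mathcal{X}}(\mathcal{A}\cap\mathcal{X})=\mathrm{pd}_{\mathcal{X}}(\omega)$. (b) $\omega={}^{\perp}(\mathcal{B}\cap\mathcal{X})\cap\mathcal{B}\cap\mathcal{X}=\mathcal{B}\cap\mathcal{X}\cap\omega^{\vee}=(\mathcal{B}\cap\mathcal{X},\omega)^{\vee}$. Furthermore: (b1) we have that $$\mathrm{id}_{\mathcal{X}}(\mathcal{B}\cap\mathcal{X})=\mathrm{id}_{\mathcal{B}\cap\mathcal{X}}(\mathcal{B}\cap\mathcal{X})=\mathrm{resdim}_{\mathcal{A}\cap\mathcal{X}}(\mathcal{B}\cap\mathcal{X})=\mathrm{resdim}_{\mathcal{A}}^{\mathcal{X}}(\mathcal{X})=\mathrm{resdim}_{\mathcal{A}}^{\mathcal{X}}(\mathcal{B}\cap\mathcal{X})$$ $$=\mathrm{resdim}_{\omega}(\mathcal{B}\cap\mathcal{X})=\mathrm{resdim}_{\mathcal{A}\cap\mathcal{X}}^{\mathcal{X}}(\mathcal{B}\cap\mathcal{X})=\mathrm{resdim}_{\mathcal{A}\cap\mathcal{X}}^{\mathcal{X}}(\mathcal{X});$$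 (b2) $\mathrm{id}_{\mathcal{B}\cap\mathcal{X}}(\mathcal{B}\cap\mathcal{X})<\infty$ if, and only if, $\mathcal{B}\cap\mathcal{X}\subseteq\omega^{\wedge}$ and $\mathrm{id}_{\mathcal{X}}(\omega)<\infty$. Moreover, if $\mathrm{id}_{\mathcal{B}\cap\mathcal{X}}(\mathcal{B}\cap\mathcal{X})<\infty$, then $\mathcal{X}\subseteq(\mathcal{A},\mathcal{X})^{\wedge}\subseteq(\mathcal{A}\cap\mathcal{X})^{\wedge}$ and $\mathrm{id}_{\mathcal{X}}(\mathcal{B}\cap\mathcal{X})=\mathrm{id}_{\mathcal{X}}(\omega)$.
   Context: $\mathrm{Ext}$ is Yoneda Ext. $\mathcal{Z}^{\perp}:=\{C : \mathrm{Ext}^i_{\mathcal{C}}(Z,C)=0\ \forall Z\in\mathcal{Z},\ i\ge1\}$ and ${}^{\perp}\mathcal{Z}:=\{C : \mathrm{Ext}^i_{\mathcal{C}}(C,Z)=0\ \forall Z\in\mathcal{Z},\ i\ge1\}$. For a class $\mathcal{Z}$ and object $C$: $\mathrm{pd}_{\mathcal{Z}}(C):=\min\{n\in\mathbb{N} : \mathrm{Ext}^k_{\mathcal{C}}(C,Z)=0\ \forall Z\in\mathcal{Z},\ \forall k>n\}$ and $\mathrm{id}_{\mathcal{Z}}(C):=\min\{n\in\mathbb{N} : \mathrm{Ext}^k_{\mathcal{C}}(Z,C)=0\ \forall Z\in\mathcal{Z},\ \forall k>n\}$ ($0\in\mathbb N$; $\infty$ if no such $n$); for a class $\mathcal{D}$,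 $\mathrm{pd}_{\mathcal{Z}}(\mathcal{D})$ and $\mathrm{id}_{\mathcal{Z}}(\mathcal{D})$ are the suprema over objects of $\mathcal{D}$. The pair $(\mathcal{A},\mathcal{B})$ is $\mathcal{X}$-hereditary if $\mathrm{id}_{\mathcal{A}\cap\mathcal{X}}(\mathcal{B}\cap\mathcal{X})=0$. It is left $\mathcal{X}$-complete if any $X\in\mathcal{X}$ admits an exact sequence $0\to B\to A\to X\to0$ with $A\in\mathcal{A}\cap\mathcal{X}$, $B\in\mathcal{B}\cap\mathcal{X}$; right $\mathcal{X}$-complete if any $X\in\mathcal{X}$ admits an exact sequence $0\to X\to B\to A\to0$ with $B\in\mathcal{B}\cap\mathcal{X}$, $A\in\mathcal{A}\cap\mathcal{X}$; and $\mathcal{X}$-complete if it is both. For classes $\mathcal{P},\mathcal{Q}\subseteq\mathcal{C}$ and $M\in\mathcal{C}$: a $\mathcal{Q}_{\mathcal{P}}$-coresolution of length $n$ of $M$ is an exact sequence $0\to M\xrightarrow{f_0}Q_0\xrightarrow{f_1}Q_1\to\cdots\xrightarrow{f_n}Q_n\to0$ with $Q_n\in\mathcal{P}\cap\mathcal{Q}$, $Q_k\in\mathcal{Q}$ for $0\le k\le n-1$, and $\mathrm{Im}(f_i)\in\mathcal{P}$ for $1\le i\le n-1$. Dually, a $\mathcal{Q}_{\mathcal{P}}$-resolution of length $n$ of $M$ is an exact sequence $0\to Q_n\xrightarrow{f_n}\cdots\to Q_1\xrightarrow{f_1}Q_0\xrightarrow{f_0}M\to0$ with $Q_n\in\mathcal{P}\cap\mathcal{Q}$,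 $Q_k\in\mathcal{Q}$ for $0\le k\le n-1$, and $\mathrm{Im}(f_i)\in\mathcal{P}$ for $1\le i\le n-1$. $\mathrm{coresdim}_{\mathcal{Q}}^{\mathcal{P}}(M)$ (resp. $\mathrm{resdim}_{\mathcal{Q}}^{\mathcal{P}}(M)$) is the smallest such $n\ge0$ ($\infty$ if none); for a class $\mathcal{D}$, $\mathrm{coresdim}_{\mathcal{Q}}^{\mathcal{P}}(\mathcal{D})$ and $\mathrm{resdim}_{\mathcal{Q}}^{\mathcal{P}}(\mathcal{D})$ are the suprema over objects of $\mathcal{D}$. $\mathcal{Q}_{\mathcal{P}}^{\vee}$ (resp. $\mathcal{Q}_{\mathcal{P}}^{\wedge}$) is the class of objects having a $\mathcal{Q}_{\mathcal{P}}$-coresolution (resp. $\mathcal{Q}_{\mathcal{P}}$-resolution) of some finite length. $(\mathcal{P},\mathcal{Q})^{\vee}:=\mathcal{P}\cap\mathcal{Q}_{\mathcal{P}}^{\vee}$ and $(\mathcal{Q},\mathcal{P})^{\wedge}:=\mathcal{Q}_{\mathcal{P}}^{\wedge}\cap\mathcal{P}$. When $\mathcal{P}=\mathcal{C}$ the symbol $\mathcal{P}$ is omitted. *)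

(* Defs.v *)
From Stdlib Require Import Relations.
From mathcomp Require Import all_boot all_algebra.
From mathcomp Require Import boolp classical_sets.

Set Implicit Arguments.
Unset Strict Implicit.
Unset Printing Implicit Defensive.

Import GRing.Theory.
Local Open Scope classical_set_scope.
Local Open Scope ring_scope.

(* The Hom groups are zmodTypes.  The choice structure that this includes is no
   restriction: [boolp] provides one on every type. *)
Record preadditive := Preadditive {
  obj :> Type;
  Hom : obj -> obj -> zmodType;
  idm : forall X, Hom X X;
  compm : forall X Y Z, Hom Y Z -> Hom X Y -> Hom X Z;
  comp_idl : forall X Y (f : Hom X Y), compm (idm Y) f = f;
  comp_idr : forall X Y (f : Hom X Y), compm f (idm X) = f;
  comp_assoc : forall X Y Z W (h : Hom Z W) (g : Hom Y Z) (f : Hom X Y),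
    compm h (compm g f) = compm (compm h g) f;
  compDl : forall X Y Z (g h : Hom Y Z) (f : Hom X Y),
    compm (g + h) f = compm g f + compm h f;
  compDr : forall X Y Z (g : Hom Y Z) (f h : Hom X Y),
    compm g (f + h) = compm g f + compm g h
}.

Arguments Hom {p} _ _.
Arguments idm {p} X.
Arguments compm {p X Y Z} _ _.

Declare Scope cat_scope.
Delimit Scope cat_scope with cat.
Notation "g ∘ f" := (compm g f) (at level 40, left associativity) : cat_scope.
Local Open Scope cat_scope.

Definition is_mono (C : preadditive) (X Y : C) (f : Hom X Y) : Prop :=
  forall (W : C) (g h : Hom W X), f ∘ g = f ∘ h -> g = h.

Definition is_epi (C : preadditive) (X Y : C) (f : Hom X Y) : Prop :=
  forall (W : C) (g h : Hom Y W), g ∘ f = h ∘ f -> g = h.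

Definition is_zero_object (C : preadditive) (Z : C) : Prop :=
  forall X : C, (forall f : Hom X Z, f = 0) /\ (forall f : Hom Z X, f = 0).

Definition is_biproduct (C : preadditive) (S M N : C) : Prop :=
  exists (i1 : Hom M S) (i2 : Hom N S) (p1 : Hom S M) (p2 : Hom S N),
    [/\ p1 ∘ i1 = idm M, p2 ∘ i2 = idm N, p1 ∘ i2 = 0, p2 ∘ i1 = 0
      & i1 ∘ p1 + i2 ∘ p2 = idm S].

Definition is_kernel (C : preadditive) (K X Y : C) (i : Hom K X) (f : Hom X Y)
    : Prop :=
  f ∘ i = 0 /\
  forall (W : C) (g : Hom W X), f ∘ g = 0 -> exists! h : Hom W K, i ∘ h = g.

Definition is_cokernel (C : preadditive) (X Y Q : C) (p : Hom Y Q) (f : Hom X Y)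
    : Prop :=
  p ∘ f = 0 /\
  forall (W : C) (g : Hom Y W), g ∘ f = 0 -> exists! h : Hom Q W, h ∘ p = g.

Record abelian := Abelian {
  ab_preadditive :> preadditive;
  ab_zero : exists Z : ab_preadditive, is_zero_object Z;
  ab_biproduct : forall M N : ab_preadditive, exists S, is_biproduct S M N;
  ab_kernel : forall (X Y : ab_preadditive) (f : Hom X Y),
    exists (K : ab_preadditive) (i : Hom K X), is_kernel i f;
  ab_cokernel : forall (X Y : ab_preadditive) (f : Hom X Y),
    exists (Q : ab_preadditive) (p : Hom Y Q), is_cokernel p f;
  ab_mono_normal : forall (X Y : ab_preadditive) (f : Hom X Y), is_mono f ->
    exists (Z : ab_preadditive) (g : Hom Y Z), is_kernel f g;
  ab_epi_normal : forall (X Y : ab_preadditive) (f : Hom X Y), is_epi f ->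
    exists (Z : ab_preadditive) (g : Hom Z X), is_cokernel f g
}.

(* Im f = Ker (Coker f), up to isomorphism. *)
Definition is_image (C : abelian) (I X Y : C) (i : Hom I Y) (f : Hom X Y)
    : Prop :=
  exists (Q : C) (p : Hom Y Q), is_cokernel p f /\ is_kernel i p.

(* Im f = Ker g as subobjects of Y.  The clauses 0 -> X -> Y and Y -> Z -> 0 of
   longer sequences are expressed by [is_mono] and [is_epi]. *)
Definition exact (C : abelian) (X Y Z : C) (f : Hom X Y) (g : Hom Y Z) : Prop :=
  exists (I : C) (i : Hom I Y), is_image i f /\ is_kernel i g.

Definition short_exact (C : abelian) (X Y Z : C) (f : Hom X Y) (g : Hom Y Z)
    : Prop :=
  [/\ is_mono f, exact f g & is_epi g].

(* Images are determined up to isomorphism: some representative lies in P. *)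
Definition image_in (C : abelian) (P : set C) (X Y : C) (f : Hom X Y) : Prop :=
  exists (I : C) (i : Hom I Y), is_image i f /\ P I.

(* The sequence M, Q 0, Q 1, ...  Since [aug M Q k.+1] reduces to [Q k], the
   maps of  M -> Q 0 -> Q 1 -> ...  form a family [f k : Hom (aug M Q k) (Q k)]
   whose consecutive members are composable. *)
Definition aug (T : Type) (M : T) (Q : nat -> T) (k : nat) : T :=
  if k is j.+1 then Q j else M.

(* An (m+1)-fold extension of X by Y is an exact sequence
     0 -> Y -f_0-> E_0 -f_1-> E_1 -> ... -f_m-> E_m -p-> X -> 0.
   Only the objects and maps of index at most m matter: the families are
   indexed by nat for convenience, and neither the axioms nor the morphisms
   of extensions constrain the values of index greater than m. *)
Record yext (C : abelian) (m : nat) (X Y : C) := YExt {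
  yobj : nat -> C;
  ymap : forall k : nat, Hom (aug Y yobj k) (yobj k);
  yepi : Hom (yobj m) X;
  yext_mono : is_mono (ymap 0);
  yext_exact : forall k : nat, (k < m)%N -> exact (ymap k) (ymap k.+1);
  yext_exact_last : exact (ymap m) yepi;
  yext_epi : is_epi yepi
}.

(* There is a morphism of extensions inducing identities on X and Y. *)
Definition yext_mor (C : abelian) (m : nat) (X Y : C) (E E' : yext m X Y)
    : Prop :=
  exists phi : forall k : nat, Hom (yobj E k) (yobj E' k),
    [/\ phi 0%N ∘ ymap E 0 = ymap E' 0,
        forall k : nat, (k < m)%N ->
          phi k.+1 ∘ ymap E k.+1 = ymap E' k.+1 ∘ phi k
      & yepi E' ∘ phi m = yepi E].

Definition yext_equiv (C : abelian) (m : nat) (X Y : C)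
    : relation (yext m X Y) :=
  clos_refl_sym_trans (yext m X Y) (@yext_mor C m X Y).

(* Ext^k(X, Y) = 0.  For k >= 1, the elements of Ext^k(X, Y) are the classes of
   k-fold extensions under [yext_equiv], and Ext^k(X, Y) = 0 says that there is
   only one class (there is always one, that of the split extension).
   Ext^0(X, Y) is Hom(X, Y). *)
Definition ext_zero (C : abelian) (k : nat) (X Y : C) : Prop :=
  if k is m.+1 then forall E E' : yext m X Y, yext_equiv E E'
  else forall f : Hom X Y, f = 0.

Definition rperp (C : abelian) (Z : set C) : set C :=
  [set M | forall (W : C) (i : nat), Z W -> (1 <= i)%N -> ext_zero i W M].

Definition lperp (C : abelian) (Z : set C) : set C :=
  [set M | forall (W : C) (i : nat), Z W -> (1 <= i)%N -> ext_zero i M W].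

Inductive enat := Fin of nat | Infty.

Definition le_enat (x y : enat) : Prop :=
  match x, y with
  | _, Infty => True
  | Infty, Fin _ => False
  | Fin m, Fin n => (m <= n)%N
  end.

(* The least n such that P n, and Infty if there is none. *)
Definition min_enat (P : nat -> Prop) : enat :=
  if pselect (exists n : nat, `[< P n >]) is left ex_n then Fin (ex_minn ex_n)
  else Infty.

(* The supremum of h over D: its least finite upper bound, Infty if there is
   none.  In particular the supremum over the empty class is Fin 0. *)
Definition sup_enat (T : Type) (D : set T) (h : T -> enat) : enat :=
  min_enat (fun n => forall M, D M -> le_enat (h M) (Fin n)).

Definition projd (C : abelian) (Z : set C) (M : C) : enat :=
  min_enat (fun n => forall (k : nat) (W : C),
    (n < k)%N -> Z W -> ext_zero k M W).

Definition injd (C : abelian) (Z : set C) (M : C) : enat :=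
  min_enat (fun n => forall (k : nat) (W : C),
    (n < k)%N -> Z W -> ext_zero k W M).

Definition projd_class (C : abelian) (Z D : set C) : enat := sup_enat D (projd Z).

Definition injd_class (C : abelian) (Z D : set C) : enat := sup_enat D (injd Z).

(* 0 -> M -f_0-> Q_0 -f_1-> Q_1 -> ... -f_n-> Q_n -> 0; only indices at most n
   matter. *)
Definition has_coresolution (C : abelian) (P Q : set C) (n : nat) (M : C)
    : Prop :=
  exists (Qs : nat -> C) (f : forall k : nat, Hom (aug M Qs k) (Qs k)),
    [/\ is_mono (f 0%N),
        forall k : nat, (k < n)%N -> exact (f k) (f k.+1)
      & is_epi (f n)] /\
    [/\ (P `&` Q) (Qs n),
        forall k : nat, (k < n)%N -> Q (Qs k)
      & forall i : nat, (1 <= i < n)%N -> image_in P (f i)].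

(* 0 -> Q_n -f_n-> ... -> Q_1 -f_1-> Q_0 -f_0-> M -> 0; only indices at most n
   matter. *)
Definition has_resolution (C : abelian) (P Q : set C) (n : nat) (M : C)
    : Prop :=
  exists (Qs : nat -> C) (f : forall k : nat, Hom (Qs k) (aug M Qs k)),
    [/\ is_mono (f n),
        forall k : nat, (k < n)%N -> exact (f k.+1) (f k)
      & is_epi (f 0%N)] /\
    [/\ (P `&` Q) (Qs n),
        forall k : nat, (k < n)%N -> Q (Qs k)
      & forall i : nat, (1 <= i < n)%N -> image_in P (f i)].

Definition coresdim (C : abelian) (P Q : set C) (M : C) : enat :=
  min_enat (fun n => has_coresolution P Q n M).

Definition resdim (C : abelian) (P Q : set C) (M : C) : enat :=
  min_enat (fun n => has_resolution P Q n M).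

(* The first class P is the superscript and the second class Q the subscript;
   an omitted superscript is [setT]. *)
Definition coresdim_class (C : abelian) (P Q D : set C) : enat :=
  sup_enat D (coresdim P Q).

Definition resdim_class (C : abelian) (P Q D : set C) : enat :=
  sup_enat D (resdim P Q).

(* [vee P Q] is Q_P^vee and [wedge P Q] is Q_P^wedge, while [pair_vee P Q] is
   (P, Q)^vee and [pair_wedge Q P] is (Q, P)^wedge. *)
Definition vee (C : abelian) (P Q : set C) : set C :=
  [set M | exists n : nat, has_coresolution P Q n M].

Definition wedge (C : abelian) (P Q : set C) : set C :=
  [set M | exists n : nat, has_resolution P Q n M].

Definition pair_vee (C : abelian) (P Q : set C) : set C := P `&` vee P Q.

Definition pair_wedge (C : abelian) (Q P : set C) : set C := wedge P Q `&` P.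

Definition closed_extensions (C : abelian) (Z : set C) : Prop :=
  forall (L M N : C) (f : Hom L M) (g : Hom M N),
    short_exact f g -> Z L -> Z N -> Z M.

Definition closed_summands (C : abelian) (Z : set C) : Prop :=
  forall S M N : C, is_biproduct S M N -> Z S -> Z M.

Definition hereditary (C : abelian) (X A B : set C) : Prop :=
  injd_class (A `&` X) (B `&` X) = Fin 0.

Definition left_complete (C : abelian) (X A B : set C) : Prop :=
  forall M : C, X M ->
    exists (K L : C) (f : Hom K L) (g : Hom L M),
      [/\ short_exact f g, (A `&` X) L & (B `&` X) K].

Definition right_complete (C : abelian) (X A B : set C) : Prop :=
  forall M : C, X M ->
    exists (K L : C) (f : Hom M K) (g : Hom K L),
      [/\ short_exact f g, (B `&` X) K & (A `&` X) L].

Definition complete (C : abelian) (X A B : set C) : Prop :=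
  left_complete X A B /\ right_complete X A B.

(* Main.v *)
(* The vanishing of Yoneda Ext has an elementary form: [Ext^n(Z, Y) = 0] iff
   for every exact sequence 0 -> K -> P_n -> ... -> P_1 -> Z -> 0 every map
   K -> Y extends to P_n after refining the sequence.  In this form the half
   exactness of [Ext] in its second variable is a short diagram chase, and
   reversing exact sequences transfers it to the first variable, as well as
   part (a) to part (b), through the opposite category.

   For part (a), M in X is coresolved by iterating right completeness: all
   cosyzygies lie in A and all terms but the first in omega.  By dimension
   shifting, the n-th cosyzygy K satisfies Ext^1(A /\ X, K) = 0 as soon as
   Ext^(n+1)(A /\ X, M) = 0, and then the sequence 0 -> K -> B' -> A' -> 0 given
   by completeness splits, so that K lies in B.  Conversely, a coresolution of
   length n of the objects of A /\ X by objects of B /\ X kills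
   Ext^k(A /\ X, A /\ X) for k > n. *)
From Stdlib Require Import Relations.
From mathcomp Require Import all_boot all_algebra.
From mathcomp Require Import boolp classical_sets.
Require Import Defs.

Set Implicit Arguments.
Unset Strict Implicit.
Unset Printing Implicit Defensive.

Import GRing.Theory.

Local Open Scope classical_set_scope.

(** * Additive and abelian categories, with duality through the opposite category *)

Section AbelianCategories.

Local Open Scope ring_scope.
Local Open Scope cat_scope.

(** Neither projectives nor injectives are available, and Yoneda equivalence is an unbounded zigzag
    of morphisms, on which a diagram chase cannot start. Refinement tames it: two refinements of one
    sequence have a common refinement, up to a coboundary ([chain_ore]), and this lets the vanishing
    of a class travel along a zigzag in both directions. Since only vanishing is ever asked, no Baer
    sum and no long exact sequence is built; a few three-term implications suffice. The dimensions
    are minima and suprema that may be infinite. They are compared through their finite upper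
    bounds: all eight of (a1) are at most [n] under one and the same condition, [extdim n]. *)

Lemma comp0l (C : preadditive) (X Y Z : C) (f : Hom X Y) :
  (0 : Hom Y Z) ∘ f = 0.
Proof. by apply: (addIr (0 ∘ f)); rewrite -compDl !add0r. Qed.

Lemma comp0r (C : preadditive) (X Y Z : C) (g : Hom Y Z) :
  g ∘ (0 : Hom X Y) = 0.
Proof. by apply: (addIr (g ∘ 0)); rewrite -compDr !add0r. Qed.

Lemma compNl (C : preadditive) (X Y Z : C) (g : Hom Y Z) (f : Hom X Y) :
  (- g) ∘ f = - (g ∘ f).
Proof. by apply: (addIr (g ∘ f)); rewrite -compDl !addNr comp0l. Qed.

Lemma compNr (C : preadditive) (X Y Z : C) (g : Hom Y Z) (f : Hom X Y) :
  g ∘ (- f) = - (g ∘ f).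
Proof. by apply: (addIr (g ∘ f)); rewrite -compDr !addNr comp0r. Qed.

Lemma compBl (C : preadditive) (X Y Z : C) (g h : Hom Y Z) (f : Hom X Y) :
  (g - h) ∘ f = g ∘ f - h ∘ f.
Proof. by rewrite compDl compNl. Qed.

Lemma compBr (C : preadditive) (X Y Z : C) (g : Hom Y Z) (f h : Hom X Y) :
  g ∘ (f - h) = g ∘ f - g ∘ h.
Proof. by rewrite compDr compNr. Qed.

Lemma mono0P (C : preadditive) (X Y : C) (f : Hom X Y) :
  is_mono f <-> forall (W : C) (g : Hom W X), f ∘ g = 0 -> g = 0.
Proof.
split=> [fm W g fg0|f0 W g h /eqP]; first by apply: fm; rewrite fg0 comp0r.
by rewrite -subr_eq0 -compBr => /eqP/f0/eqP; rewrite subr_eq0 => /eqP.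
Qed.

Lemma epi0P (C : preadditive) (X Y : C) (f : Hom X Y) :
  is_epi f <-> forall (W : C) (g : Hom Y W), g ∘ f = 0 -> g = 0.
Proof.
split=> [fe W g fg0|f0 W g h /eqP]; first by apply: fe; rewrite fg0 comp0l.
by rewrite -subr_eq0 -compBl => /eqP/f0/eqP; rewrite subr_eq0 => /eqP.
Qed.

Definition opp_preadditive (C : preadditive) : preadditive :=
  @Preadditive C (fun X Y => Hom Y X) (fun X => idm X)
    (fun X Y Z g f => f ∘ g)
    (fun X Y f => comp_idr f) (fun X Y f => comp_idl f)
    (fun X Y Z W h g f => esym (comp_assoc f g h))
    (fun X Y Z g h f => compDr f g h) (fun X Y Z g f h => compDl f h g).

Lemma opp_biproduct (C : preadditive) (S M N : C) :
  is_biproduct S M N -> @is_biproduct (opp_preadditive C) S M N.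
Proof.
by move=> [i1 [i2 [p1 [p2 [? ? ? ? ?]]]]]; exists p1, p2, i1, i2; split.
Qed.

Lemma opp_zero (C : preadditive) (Z : C) :
  is_zero_object Z -> @is_zero_object (opp_preadditive C) Z.
Proof. by move=> hZ X; have [? ?] := hZ X; split. Qed.

(** Transparent, so that objects and morphisms of [opp C] compute to those of [C]: classes of
    objects are shared, and kernels and cokernels swap by conversion. *)
Definition opp (C : abelian) : abelian.
Proof.
refine (@Abelian (opp_preadditive C) _ _ _ _ _ _).
- by have [Z hZ] := ab_zero C; exists Z; apply: opp_zero.
- move=> M N; have [S hS] := ab_biproduct M N.
  by exists S; apply: opp_biproduct.
- exact: (fun X Y f => @ab_cokernel C Y X f).
- exact: (fun X Y f => @ab_kernel C Y X f).
- exact: (fun X Y f => @ab_epi_normal C Y X f).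
- exact: (fun X Y f => @ab_mono_normal C Y X f).
Defined.

Lemma kernel_mono (C : preadditive) (K X Y : C) (i : Hom K X) (f : Hom X Y) :
  is_kernel i f -> is_mono i.
Proof.
move=> [fi0 hi]; apply/mono0P => W g ig0.
have [h [_ hu]] := hi W 0 (comp0r _ _).
by rewrite -(hu g ig0) -(hu 0 (comp0r _ _)).
Qed.

Lemma cokernel_epi (C : preadditive) (X Y Q : C) (p : Hom Y Q) (f : Hom X Y) :
  is_cokernel p f -> is_epi p.
Proof. exact: (@kernel_mono (opp_preadditive C)). Qed.

Lemma kernel_lift (C : preadditive) (K X Y W : C) (i : Hom K X) (f : Hom X Y)
    (g : Hom W X) :
  is_kernel i f -> f ∘ g = 0 -> exists h : Hom W K, i ∘ h = g.
Proof. by move=> [_ hi] /hi[h [? _]]; exists h. Qed.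

Lemma cokernel_desc (C : preadditive) (X Y Q W : C) (p : Hom Y Q)
    (f : Hom X Y) (g : Hom Y W) :
  is_cokernel p f -> g ∘ f = 0 -> exists h : Hom Q W, h ∘ p = g.
Proof. by move=> [_ hi] /hi[h [? _]]; exists h. Qed.

Lemma kernelP (C : preadditive) (K X Y : C) (i : Hom K X) (f : Hom X Y) :
  is_mono i -> f ∘ i = 0 ->
  (forall (W : C) (g : Hom W X), f ∘ g = 0 -> exists h : Hom W K, i ∘ h = g) ->
  is_kernel i f.
Proof.
move=> im fi0 hi; split=> // W g /hi[h hg]; exists h; split=> // h' hg'.
by apply: im; rewrite hg hg'.
Qed.

Lemma cokernelP (C : preadditive) (X Y Q : C) (p : Hom Y Q) (f : Hom X Y) :
  is_epi p -> p ∘ f = 0 ->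
  (forall (W : C) (g : Hom Y W), g ∘ f = 0 -> exists h : Hom Q W, h ∘ p = g) ->
  is_cokernel p f.
Proof. exact: (@kernelP (opp_preadditive C)). Qed.

Lemma mono_comp (C : preadditive) (X Y Z : C) (g : Hom Y Z) (f : Hom X Y) :
  is_mono g -> is_mono f -> is_mono (g ∘ f).
Proof. by move=> gm fm W u v; rewrite -!comp_assoc => /gm/fm. Qed.

Lemma epi_comp (C : preadditive) (X Y Z : C) (g : Hom Y Z) (f : Hom X Y) :
  is_epi g -> is_epi f -> is_epi (g ∘ f).
Proof. by move=> ge fe; apply: (@mono_comp (opp_preadditive C)). Qed.

Lemma mono_idm (C : preadditive) (X : C) : is_mono (idm X).
Proof. by move=> W u v; rewrite !comp_idl. Qed.

Lemma epi_idm (C : preadditive) (X : C) : is_epi (idm X).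
Proof. by move=> W u v; rewrite !comp_idr. Qed.

Definition is_iso (C : preadditive) (X Y : C) (f : Hom X Y) : Prop :=
  exists g : Hom Y X, g ∘ f = idm X /\ f ∘ g = idm Y.

Lemma iso_mono (C : preadditive) (X Y : C) (f : Hom X Y) : is_iso f -> is_mono f.
Proof.
by move=> [g [gf _]] W u v /(congr1 (compm g)); rewrite !comp_assoc gf !comp_idl.
Qed.

Lemma opp_iso (C : preadditive) (X Y : C) (f : Hom X Y) :
  is_iso f -> @is_iso (opp_preadditive C) Y X f.
Proof. by move=> [g [? ?]]; exists g. Qed.

Lemma iso_epi (C : preadditive) (X Y : C) (f : Hom X Y) : is_iso f -> is_epi f.
Proof. by move/opp_iso/iso_mono. Qed.

Lemma mono_epi_iso (C : abelian) (X Y : C) (f : Hom X Y) :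
  is_mono f -> is_epi f -> is_iso f.
Proof.
move=> fm fe; have [Z [g kfg]] := ab_mono_normal fm.
have g0 : g = 0 by apply: ((epi0P f).1 fe); case: kfg.
have [h fh] := kernel_lift (g := idm Y) kfg (etrans (comp_idr _) g0).
exists h; split=> //; apply: fm; by rewrite comp_assoc fh comp_idl comp_idr.
Qed.

Lemma mono_kernel (C : abelian) (X Y Q : C) (f : Hom X Y) (p : Hom Y Q) :
  is_mono f -> is_cokernel p f -> is_kernel f p.
Proof.
move=> fm cpf; have [Z [g kfg]] := ab_mono_normal fm.
apply: kernelP => //; first by case: cpf.
move=> W u pu; apply: (kernel_lift kfg).
have [h <-] := cokernel_desc cpf (proj1 kfg).
by rewrite -comp_assoc pu comp0r.
Qed.

Lemma epi_cokernel (C : abelian) (K X Y : C) (f : Hom X Y) (i : Hom K X) :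
  is_epi f -> is_kernel i f -> is_cokernel f i.
Proof. exact: (@mono_kernel (opp C)). Qed.

Lemma cokernel_comp_epi (C : preadditive) (W X Y Q : C) (p : Hom Y Q)
    (f : Hom X Y) (e : Hom W X) :
  is_epi e -> is_cokernel p f <-> is_cokernel p (f ∘ e).
Proof.
move=> /epi0P ee; split=> cpf.
  have [pf0 _] := cpf; apply: cokernelP; first exact: cokernel_epi cpf.
    by rewrite comp_assoc pf0 comp0l.
  by move=> V g; rewrite comp_assoc => /ee; apply: cokernel_desc.
have [pf0 _] := cpf; apply: cokernelP; first exact: cokernel_epi cpf.
  by apply: ee; rewrite -comp_assoc.
move=> V g gf; apply: (cokernel_desc cpf).
by rewrite comp_assoc gf comp0l.
Qed.

Lemma imageP (C : abelian) (I X Y : C) (i : Hom I Y) (f : Hom X Y) :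
  is_image i f <-> is_mono i /\ exists2 e : Hom X I, is_epi e & f = i ∘ e.
Proof.
split=> [[Q [p [cpf kip]]]|[im [e ee ->]]]; last first.
  have [Q [p cpi]] := ab_cokernel i; exists Q, p; split; last exact: mono_kernel.
  exact: (cokernel_comp_epi p i ee).1 cpi.
have im := kernel_mono kip; split=> //.
have [e def_f] := kernel_lift kip (proj1 cpf); exists e => //.
(* If [h] kills [e], then [e] factors through the kernel [k] of [h]. By normality [i ∘ k] is the
   kernel of some [g]; this [g] kills [f], hence factors through [p] and kills [i]. So [i] factors
   through [i ∘ k], which splits [k] and forces [h = 0]. *)
apply/epi0P => W h he0; have [J [k kk]] := ab_kernel h.
have [e' def_e] := kernel_lift kk he0.
have km := kernel_mono kk.
have [Z [g kg]] := ab_mono_normal (mono_comp im km).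
have [g' def_g] : exists g' : Hom Q Z, g' ∘ p = g.
  apply: (cokernel_desc cpf).
  by rewrite -def_f -def_e !comp_assoc -[_ ∘ k]comp_assoc (proj1 kg) comp0l.
have [t it] : exists t : Hom I J, (i ∘ k) ∘ t = i.
  by apply: (kernel_lift kg); rewrite -def_g -comp_assoc (proj1 kip) comp0r.
have {}it : k ∘ t = idm I by apply: im; rewrite comp_assoc it comp_idr.
by rewrite -[h]comp_idr -it comp_assoc (proj1 kk) comp0l.
Qed.

Lemma ex_image (C : abelian) (X Y : C) (f : Hom X Y) :
  exists (I : C) (i : Hom I Y), is_image i f.
Proof.
have [Q [p cpf]] := ab_cokernel f; have [I [i kip]] := ab_kernel p.
by exists I, i, Q, p.
Qed.

Definition ses (C : abelian) (X Y Z : C) (f : Hom X Y) (g : Hom Y Z) : Prop :=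
  is_kernel f g /\ is_epi g.

Lemma ses_cokernel (C : abelian) (X Y Z : C) (f : Hom X Y) (g : Hom Y Z) :
  ses f g -> is_cokernel g f.
Proof. by move=> [kf ge]; apply: epi_cokernel. Qed.

Lemma opp_ses (C : abelian) (X Y Z : C) (f : Hom X Y) (g : Hom Y Z) :
  ses f g -> @ses (opp C) Z Y X g f.
Proof.
by move=> s; split; [exact: (ses_cokernel s)|case: s => /kernel_mono].
Qed.

Lemma opp_ses_inv (C : abelian) (X Y Z : C) (f : Hom X Y) (g : Hom Y Z) :
  @ses (opp C) Z Y X g f -> ses f g.
Proof.
move=> s; split; last by case: s => /kernel_mono.
exact: (ses_cokernel s).
Qed.

Lemma exactP (C : abelian) (X Y Z : C) (f : Hom X Y) (g : Hom Y Z) :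
  exact f g <-> exists (I : C) (i : Hom I Y) (e : Hom X I),
    [/\ is_epi e, f = i ∘ e & is_kernel i g].
Proof.
split=> [[I [i [/imageP[im [e ee fE]] ki]]]|[I [i [e [ee fE ki]]]]].
  by exists I, i, e.
exists I, i; split=> //; apply/imageP; split; first exact: kernel_mono ki.
by exists e.
Qed.

Lemma mono_exact_kernel (C : abelian) (X Y Z : C) (f : Hom X Y) (g : Hom Y Z) :
  is_mono f -> exact f g -> is_kernel f g.
Proof.
move=> fm /exactP[I [i [e [ee fE ki]]]].
have em : is_mono e.
  by move=> W u v euv; apply: fm; rewrite fE -!comp_assoc euv.
have [e' [e'e ee']] := mono_epi_iso em ee.
apply: kernelP => //; first by rewrite fE comp_assoc (proj1 ki) comp0l.
move=> W u gu; have [h <-] := kernel_lift ki gu.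
by exists (e' ∘ h); rewrite fE -comp_assoc [e ∘ _]comp_assoc ee' comp_idl.
Qed.

Lemma short_exactP (C : abelian) (X Y Z : C) (f : Hom X Y) (g : Hom Y Z) :
  short_exact f g <-> ses f g.
Proof.
split=> [[fm ex ge]|[kf ge]].
  by split=> //; apply: mono_exact_kernel.
split=> //; first exact: kernel_mono kf.
by apply/exactP; exists X, f, (idm X); rewrite comp_idr; split=> //; apply: epi_idm.
Qed.

(** With image factorisations [f = i ∘ e] and [g = m ∘ c], exactness says that [i] is the kernel of
    [g], hence of [c]; so [c] is the cokernel of [i], hence of [f], which is the dual statement. *)
Lemma exact_opp (C : abelian) (X Y Z : C) (f : Hom X Y) (g : Hom Y Z) :
  exact f g -> @exact (opp C) Z Y X g f.
Proof.
move=> /exactP[I [i [e [ee fE ki]]]]; apply/exactP.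
have [J [m /imageP[mm [c ce gE]]]] := ex_image g.
exists J, c, m; split=> //.
suff cc : is_cokernel c i by rewrite fE; apply: (cokernel_comp_epi _ _ ee).1 cc.
apply: epi_cokernel => //.
by rewrite gE in ki; apply: (@cokernel_comp_epi (opp C) _ _ _ _ i c m mm).2 ki.
Qed.

Lemma exact_opp_inv (C : abelian) (X Y Z : C) (f : Hom X Y) (g : Hom Y Z) :
  @exact (opp C) Z Y X g f -> exact f g.
Proof.
(* Objects, morphisms and composition of the double opposite compute to those of [C], and exactness
   depends on nothing else. *)
case: C X Y Z f g => [[? ? ? ? ? ? ? ? ?] ? ? ? ? ? ?] X Y Z f g.
exact: exact_opp.
Qed.

Lemma image_opp (C : abelian) (P : set C) (X Y : C) (f : Hom X Y) :
  image_in P f -> @image_in (opp C) P Y X f.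
Proof.
move=> [I [i [/imageP[im [e ee fE]] PI]]]; exists I, e; split=> //.
by apply/imageP; split=> //; exists i.
Qed.

Lemma image_opp_inv (C : abelian) (P : set C) (X Y : C) (f : Hom X Y) :
  @image_in (opp C) P Y X f -> image_in P f.
Proof.
move=> [I [i [/imageP[im [e ee fE]] PI]]]; exists I, e; split=> //.
by apply/imageP; split=> //; exists i.
Qed.

Lemma exact_comp_epi (C : abelian) (W X Y Z : C) (f : Hom X Y) (g : Hom Y Z)
    (e : Hom W X) :
  is_epi e -> exact f g -> exact (f ∘ e) g.
Proof.
move=> ee /exactP[I [i [e' [ee' -> ki]]]]; apply/exactP.
by exists I, i, (e' ∘ e); rewrite comp_assoc; split=> //; apply: epi_comp.
Qed.

Lemma exact_mono_comp (C : abelian) (X Y Z W : C) (f : Hom X Y) (g : Hom Y Z)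
    (m : Hom Z W) :
  is_mono m -> exact f g -> exact f (m ∘ g).
Proof.
move=> mm /exact_opp ex; apply: exact_opp_inv.
exact: (@exact_comp_epi (opp C)).
Qed.

(* Pull [f] back along [g]: the projection to [W] is still epi. *)
Lemma epi_lift (C : abelian) (X Y W : C) (f : Hom X Y) (g : Hom W Y) :
  is_epi f -> exists (V : C) (e : Hom V W) (h : Hom V X),
    is_epi e /\ f ∘ h = g ∘ e.
Proof.
move=> /epi0P fe.
have [S [i1 [i2 [p1 [p2 [pi11 pi22 pi12 pi21 _]]]]]] := ab_biproduct X W.
pose d := f ∘ p1 - g ∘ p2.
have di1 : d ∘ i1 = f.
  by rewrite compBl -!comp_assoc pi11 pi21 comp0r comp_idr subr0.
have de : is_epi d.
  by apply/epi0P => V u ud; apply: fe; rewrite -di1 comp_assoc ud comp0l.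
have [V [k kk]] := ab_kernel d.
exists V, (p2 ∘ k), (p1 ∘ k); split; last first.
  by apply/eqP; rewrite -subr_eq0 !comp_assoc -compBl (proj1 kk).
apply/epi0P => U u; rewrite comp_assoc => upk.
have [v def_v] := cokernel_desc (epi_cokernel de kk) upk.
have v0 : v = 0.
  by apply: fe; rewrite -di1 comp_assoc def_v -comp_assoc pi21 comp0r.
rewrite v0 comp0l in def_v.
by rewrite -[u]comp_idr -pi22 comp_assoc -def_v comp0l.
Qed.

(** Belonging to a subobject means vanishing in the cokernel, which can be tested after an
    epimorphism. With [epi_lift] this replaces chases with elements. *)
Lemma mono_lift_local (C : abelian) (X Y W V : C) (i : Hom X Y) (w : Hom W Y)
    (e : Hom V W) (s : Hom V X) :
  is_mono i -> is_epi e -> i ∘ s = w ∘ e -> exists t : Hom W X, i ∘ t = w.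
Proof.
move=> im /epi0P ee is_we; have [Q [c cc]] := ab_cokernel i.
apply: (kernel_lift (mono_kernel im cc)); apply: ee.
by rewrite -comp_assoc -is_we comp_assoc (proj1 cc) comp0l.
Qed.

Lemma ses_kernel_exists (C : abelian) (Y Z : C) (g : Hom Y Z) :
  is_epi g -> exists (X : C) (f : Hom X Y), ses f g.
Proof. by have [X [f kf]] := ab_kernel g; exists X, f. Qed.

(** The pushout is the cokernel of [d = (x, -j)] from [K] to the biproduct of [Y] and [P]; [d] is
    mono because [j] is. *)
Lemma ses_pushout (C : abelian) (K P L Y : C) (j : Hom K P) (q : Hom P L)
    (x : Hom K Y) :
  ses j q -> exists (Q : C) (i : Hom Y Q) (g : Hom P Q) (r : Hom Q L),
    [/\ ses i r, i ∘ x = g ∘ j, r ∘ g = q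
      & forall (T : C) (a : Hom Y T) (b : Hom P T), a ∘ x = b ∘ j ->
          exists t : Hom Q T, t ∘ i = a /\ t ∘ g = b].
Proof.
move=> [kj qe]; have /mono0P jm := kernel_mono kj; have [qj0 _] := kj.
have [S [i1 [i2 [p1 [p2 [pi11 pi22 pi12 pi21 pid]]]]]] := ab_biproduct Y P.
pose d := i1 ∘ x - i2 ∘ j.
have p2d : p2 ∘ d = - j.
  by rewrite compBr !comp_assoc pi21 pi22 comp0l comp_idl sub0r.
have dm : is_mono d.
  apply/mono0P => W u du; apply: jm; apply: oppr_inj.
  by rewrite -compNl -p2d -comp_assoc du comp0r oppr0.
have [Q [pr cpr]] := ab_cokernel d; have pre := cokernel_epi cpr.
have [prd _] := cpr.
have [r def_r] : exists r : Hom Q L, r ∘ pr = q ∘ p2.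
  by apply: (cokernel_desc cpr); rewrite -comp_assoc p2d compNr qj0 oppr0.
have rg : r ∘ (pr ∘ i2) = q.
  by rewrite comp_assoc def_r -comp_assoc pi22 comp_idr.
have com : (pr ∘ i1) ∘ x = (pr ∘ i2) ∘ j.
  by apply/eqP; rewrite -subr_eq0 -!comp_assoc -compBr prd.
have im : is_mono (pr ∘ i1).
  apply/mono0P => W u; rewrite -comp_assoc => piu.
  have [t dt] := kernel_lift (mono_kernel dm cpr) piu.
  have t0 : t = 0.
    apply: jm; apply: oppr_inj; rewrite -compNl -p2d -comp_assoc dt.
    by rewrite comp_assoc pi21 comp0l oppr0.
  have : p1 ∘ (i1 ∘ u) = 0 by rewrite -dt t0 !comp0r.
  by rewrite comp_assoc pi11 comp_idl.
exists Q, (pr ∘ i1), (pr ∘ i2), r; split=> //; last first.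
  move=> T a b ab.
  have [t def_t] : exists t : Hom Q T, t ∘ pr = a ∘ p1 + b ∘ p2.
    apply: (cokernel_desc cpr); rewrite compDl -![_ ∘ p1 ∘ _]comp_assoc.
    rewrite -[_ ∘ p2 ∘ _]comp_assoc p2d compBr !comp_assoc pi11 comp_idl.
    by rewrite pi12 comp0l subr0 compNr ab subrr.
  exists t; rewrite !comp_assoc def_t !compDl -!comp_assoc.
  by rewrite pi11 pi22 pi12 pi21 !comp0r !comp_idr addr0 add0r.
split; last by move=> W u v /(congr1 (compm^~ (pr ∘ i2)));
  rewrite -!comp_assoc rg => /qe.
apply: kernelP => //.
  by rewrite comp_assoc def_r -comp_assoc pi21 comp0r.
(* Lift [w] locally to the biproduct. Its component in [P] is killed by [q], so it comes from [K] by
   some [t] and is moved over to [Y] as [x ∘ t]. *)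
move=> W w rw; have [V [e [h [ee prh]]]] := epi_lift w pre.
have [t jt] : exists t : Hom V K, j ∘ t = p2 ∘ h.
  apply: (kernel_lift kj).
  by rewrite comp_assoc -def_r -comp_assoc prh comp_assoc rw comp0l.
apply: (mono_lift_local (s := p1 ∘ h + x ∘ t) im ee).
rewrite -prh -[h in RHS]comp_idl -pid compDl !compDr !comp_assoc com.
by rewrite -!comp_assoc jt.
Qed.

(** * Vanishing of Ext by refinement of exact sequences *)

(* [chain Z n K]: an exact sequence 0 -> K -> P_n -> ... -> P_1 -> Z -> 0, cut
   into short exact sequences. *)
Inductive chain (C : abelian) (Z : C) : nat -> C -> Type :=
| cnil : chain Z 0 Z
| csnoc (n : nat) (K N P : C) (c : chain Z n K) (j : Hom N P) (q : Hom P K)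
    (s : ses j q) : chain Z n.+1 N.

(** This and [chainS_ind] are inversions at a fixed length. The return type of the match computes on
    the length, so no equation between indices arises. *)
Lemma chain0_ind (C : abelian) (Z : C) (T : forall K, chain Z 0 K -> Prop) :
  T Z (cnil Z) -> forall K (c : chain Z 0 K), T K c.
Proof.
move=> T0 K c.
exact: (match c as c0 in chain _ n K0
  return match n return chain Z n K0 -> Prop with
         | 0%N => fun c1 => T K0 c1 | _ => fun _ => True end c0
  with cnil => T0 | csnoc _ _ _ _ _ _ _ _ => I end).
Qed.

Lemma chainS_ind (C : abelian) (Z : C) (n : nat)
    (T : forall N, chain Z n.+1 N -> Prop) :
  (forall K N P (c : chain Z n K) (j : Hom N P) (q : Hom P K) (s : ses j q),
    T N (csnoc c s)) ->
  forall N (c : chain Z n.+1 N), T N c.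
Proof.
move=> TS N c.
move: T TS; refine (match c as c0 in chain _ m N0
  return match m return chain Z m N0 -> Prop with
         | 0%N => fun _ => True
         | n.+1 => fun c1 => forall T : forall N, chain Z n.+1 N -> Prop,
             (forall K N P (c : chain Z n K) (j : Hom N P) (q : Hom P K)
               (s : ses j q), T N (csnoc c s)) -> T N0 c1 end c0
  with cnil => I | csnoc _ _ _ _ _ _ _ _ => _ end).
by move=> T TS; apply: TS.
Qed.

(* Morphisms of chains over [z]; [k] is the component at the far end. *)
Fixpoint cmor (C : abelian) (Z Z' : C) (z : Hom Z Z') (n : nat) (K : C)
    (c : chain Z n K) {struct c} : forall K', chain Z' n K' -> Hom K K' -> Prop :=
  match c in chain _ n0 K0
    return forall K', chain Z' n0 K' -> Hom K0 K' -> Prop with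
  | cnil => fun K' c' =>
      match c' in chain _ m K1 return Hom Z K1 -> Prop with
      | cnil => fun k => k = z
      | csnoc _ _ _ _ _ _ _ _ => fun _ => False
      end
  | csnoc n K N P c j q s => fun N' c' =>
      match c' in chain _ m N1
        return (forall L, chain Z' m.-1 L -> Hom K L -> Prop) -> Hom N N1 -> Prop
      with
      | cnil => fun _ _ => False
      | csnoc _ K' _ P' c0' j' q' s' => fun rec k =>
          exists (l : Hom K K') (p : Hom P P'),
            [/\ rec K' c0' l, j' ∘ k = p ∘ j & q' ∘ p = l ∘ q]
      end (cmor z c)
  end.

Lemma cmor_comp (C : abelian) (Z Z' Z'' : C) (z : Hom Z Z') (z' : Hom Z' Z'')
    (n : nat) (K K' K'' : C) (c : chain Z n K) (c' : chain Z' n K')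
    (c'' : chain Z'' n K'') (k : Hom K K') (k' : Hom K' K'') :
  cmor z c c' k -> cmor z' c' c'' k' -> cmor (z' ∘ z) c c'' (k' ∘ k).
Proof.
elim: n K c K' c' K'' c'' k k' => [|n IHn].
  move=> K c; elim/chain0_ind: K / c => K' c'; elim/chain0_ind: K' / c'.
  by move=> K'' c''; elim/chain0_ind: K'' / c'' => k k' /= -> ->.
move=> K0 c; elim/chainS_ind: K0 / c => K N P c j q s.
move=> K0 c'; elim/chainS_ind: K0 / c' => K' N' P' c' j' q' s'.
move=> K0 c''; elim/chainS_ind: K0 / c'' => K'' N'' P'' c'' j'' q'' s'' k k' /=.
move=> [l [p [cc' jk qp]]] [l' [p' [cc'' jk' qp']]].
exists (l' ∘ l), (p' ∘ p); split; first exact: IHn cc' cc''.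
  by rewrite comp_assoc jk' -!comp_assoc jk.
by rewrite comp_assoc qp' -!comp_assoc qp.
Qed.

Lemma cmor_id (C : abelian) (Z : C) (n : nat) (K : C) (c : chain Z n K) :
  cmor (idm Z) c c (idm K).
Proof.
elim: c => //= {}n {}K N P c IHc j q s.
by exists (idm K), (idm P); rewrite !comp_idl !comp_idr.
Qed.

Lemma cmor_comp_id (C : abelian) (Z : C) (n : nat) (K K' K'' : C)
    (c : chain Z n K) (c' : chain Z n K') (c'' : chain Z n K'') (k : Hom K K')
    (k' : Hom K' K'') :
  cmor (idm Z) c c' k -> cmor (idm Z) c' c'' k' ->
  cmor (idm Z) c c'' (k' ∘ k).
Proof.
by move=> cc' cc''; rewrite -[idm Z]comp_idl; apply: cmor_comp cc' cc''.
Qed.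

(* [x] is a coboundary: it extends over the last monomorphism of the chain. *)
Definition bd (C : abelian) (Z : C) (n : nat) (K : C) (c : chain Z n K) (Y : C) :
    Hom K Y -> Prop :=
  match c with
  | cnil => fun x => x = 0
  | csnoc _ _ _ P _ j _ _ => fun x => exists t : Hom P Y, x = t ∘ j
  end.

Lemma bd_pull (C : abelian) (Z Z' : C) (z : Hom Z' Z) (n : nat) (K K' : C)
    (c' : chain Z' n K') (c : chain Z n K) (k : Hom K' K) (Y : C) (x : Hom K Y) :
  cmor z c' c k -> bd c x -> bd c' (x ∘ k).
Proof.
case: n K c K' c' k x => [|n].
  move=> K0 c; elim/chain0_ind: K0 / c => K1 c'; elim/chain0_ind: K1 / c' => k x /=.
  by move=> _ ->; rewrite comp0l.
move=> K0 c; elim/chainS_ind: K0 / c => K N P c j q s.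
move=> K0 c'; elim/chainS_ind: K0 / c' => K' N' P' c' j' q' s' k x /=.
move=> [l [p [_ jk _]]] [t ->]; exists (t ∘ p).
by rewrite -!comp_assoc jk.
Qed.

Lemma bd_push (C : abelian) (Z : C) (n : nat) (K : C) (c : chain Z n K)
    (Y Y' : C) (x : Hom K Y) (y : Hom Y Y') : bd c x -> bd c (y ∘ x).
Proof.
case: c x => [x ->|m L N P c j q s x [t ->]] /=; first by rewrite comp0r.
by exists (y ∘ t); rewrite comp_assoc.
Qed.

Lemma bdB (C : abelian) (Z : C) (n : nat) (K : C) (c : chain Z n K)
    (Y : C) (x y : Hom K Y) : bd c x -> bd c y -> bd c (x - y).
Proof.
case: c x y => [x y -> ->|m L N P c j q s x y [t ->] [u ->]] /=.
  by rewrite subrr.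
by exists (t - u); rewrite compBl.
Qed.

(** The two commuting squares are exactly what one more step of a morphism of chains asks for. *)
Lemma ses_pullback (C : abelian) (N P K K' : C) (j : Hom N P) (q : Hom P K)
    (k : Hom K' K) :
  ses j q -> exists (N' P' : C) (j' : Hom N' P') (q' : Hom P' K')
      (p : Hom P' P) (m : Hom N' N),
    [/\ ses j' q', q ∘ p = k ∘ q' & j ∘ m = p ∘ j'].
Proof.
move=> [kj qe]; have [P' [q' [p [qe' qp]]]] := epi_lift k qe.
have [N' [j' s']] := ses_kernel_exists qe'.
have [m jm] : exists m : Hom N' N, j ∘ m = p ∘ j'.
  by apply: (kernel_lift kj);
     rewrite comp_assoc qp -comp_assoc (proj1 (proj1 s')) comp0r.
by exists N', P', j', q', p, m.
Qed.

Lemma chain_pullback (C : abelian) (Z : C) (n : nat) (K' K N P : C)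
    (c' : chain Z n K') (c : chain Z n K) (k : Hom K' K) (j : Hom N P)
    (q : Hom P K) (s : ses j q) :
  cmor (idm Z) c' c k ->
  exists (N' P' : C) (j' : Hom N' P') (q' : Hom P' K') (s' : ses j' q')
      (p : Hom P' P) (m : Hom N' N),
    [/\ cmor (idm Z) (csnoc c' s') (csnoc c s) m, q ∘ p = k ∘ q'
      & j ∘ m = p ∘ j'].
Proof.
move=> c'c; have [N' [P' [j' [q' [p [m [s' qp jm]]]]]]] := ses_pullback k s.
by exists N', P', j', q', s', p, m; split=> //; exists k, p.
Qed.

(** The extension [t] of [x] to the last term [P] lifts through [p] on a cover of [P]. Putting the
    cover in place of [P] refines the chain in its last step only. *)
Lemma bd_lift (C : abelian) (Z : C) (n : nat) (K : C) (c : chain Z n K)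
    (Y W : C) (p : Hom Y W) (x : Hom K W) :
  is_epi p -> bd c x ->
  exists (K' : C) (c' : chain Z n K') (k : Hom K' K) (y : Hom K' Y),
    [/\ cmor (idm Z) c' c k, bd c' y & p ∘ y = x ∘ k].
Proof.
move=> pe; case: c x => [x /= ->|m L N P c j q s x [t ->]] /=.
  exists Z, (cnil Z), (idm Z), 0; split=> //=.
  by rewrite comp0l comp0r.
have [P' [e [h [ee ph]]]] := epi_lift t pe.
have [N' [j' s']] := ses_kernel_exists (epi_comp (proj2 s) ee).
have [k jk] : exists k : Hom N' N, j ∘ k = e ∘ j'.
  apply: (kernel_lift (proj1 s)); rewrite comp_assoc.
  exact: (proj1 (proj1 s')).
exists N', (csnoc c s'), k, (h ∘ j'); split; last 2 first.
- by exists h.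
- by rewrite comp_assoc ph -!comp_assoc jk.
by exists (idm L), e; rewrite comp_idl; split=> //; exact: cmor_id.
Qed.

(* The vanishing of Ext^n(Z, Y), computed as a filtered colimit over chains: a
   class is a chain together with a map [x : K -> Y], and it vanishes when [x]
   becomes a coboundary after a refinement of the chain. *)
Definition evan (C : abelian) (n : nat) (Z Y : C) : Prop :=
  forall (K : C) (c : chain Z n K) (x : Hom K Y),
    exists (K' : C) (c' : chain Z n K') (k : Hom K' K),
      cmor (idm Z) c' c k /\ bd c' (x ∘ k).

(** Pulling the sequence back along [x] yields the connecting class [m]. Once [m ∘ k] extends to
    [r], the map [h ∘ a - i ∘ r] descends to a lift [y] of [x] to [Y], whose class vanishes. *)
Lemma evan_ses3 (C : abelian) (n : nat) (Z K Y W : C) (i : Hom K Y)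
    (p : Hom Y W) :
  ses i p -> evan n Z Y -> evan n.+1 Z K -> evan n Z W.
Proof.
move=> sip vY vK L c x; have [ki pe] := sip; have [pi0 _] := ki.
have [N [P [j [q [h [m [s ph im]]]]]]] := ses_pullback x sip.
have [N1 [c1 [k [c1c x1]]]] := vK N (csnoc c s) m.
elim/chainS_ind: N1 / c1 k c1c x1 => L1 N1 P1 c1 j1 q1 s1 k /= [l [a [c1c jk qa]]] [r mk].
have [y def_y] : exists y : Hom L1 Y, y ∘ q1 = h ∘ a - i ∘ r.
  apply: (cokernel_desc (ses_cokernel s1)).
  by rewrite compBl -!comp_assoc -mk -jk !comp_assoc im subrr.
have py : p ∘ y = x ∘ l.
  apply: (proj2 s1); rewrite -comp_assoc def_y compBr !comp_assoc pi0 comp0l subr0.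
  by rewrite ph -!comp_assoc qa.
have [L2 [c2 [l2 [c2c1 y2]]]] := vY L1 c1 y.
exists L2, c2, (l ∘ l2); split; first exact: cmor_comp_id c2c1 c1c.
by rewrite comp_assoc -py -comp_assoc; apply: bd_push.
Qed.

(** An extension [y] of [i ∘ x] has an obstruction [w] to landing in [K]: a class of one degree less
    with values in [W]. It vanishes, and its coboundary lifts to [v] with values in [Y]; then
    [y ∘ a - v ∘ q3] lands in [K] and restricts to the same map, as [q3 ∘ j3 = 0]. *)
Lemma evan_ses1 (C : abelian) (n : nat) (Z K Y W : C) (i : Hom K Y)
    (p : Hom Y W) :
  ses i p -> evan n Z W -> evan n.+1 Z Y -> evan n.+1 Z K.
Proof.
move=> sip vW vY; move=> K0 c; elim/chainS_ind: K0 / c => L N P c j q s x.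
have [ki pe] := sip; have [pi0 _] := ki; have im := kernel_mono ki.
have [N1 [c1 [k [c1c x1]]]] := vY N (csnoc c s) (i ∘ x).
elim/chainS_ind: N1 / c1 k c1c x1 => L1 N1 P1 c1 j1 q1 s1 k c1c /= [y ixk].
have [w def_w] : exists w : Hom L1 W, w ∘ q1 = p ∘ y.
  apply: (cokernel_desc (ses_cokernel s1)).
  by rewrite -comp_assoc -ixk !comp_assoc pi0 !comp0l.
have [L2 [c2 [l2 [c2c1 w2]]]] := vW L1 c1 w.
have [L3 [c3 [l3 [v [c3c2 v3 pv]]]]] := bd_lift pe w2.
have c3c1 := cmor_comp_id c3c2 c2c1.
have [N3 [P3 [j3 [q3 [s3 [a [m [c3c1' qa jm]]]]]]]] := chain_pullback s1 c3c1.
exists N3, (csnoc c3 s3), (k ∘ m); split; first exact: cmor_comp_id c3c1' c1c.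
have [z iz] : exists z : Hom P3 K, i ∘ z = y ∘ a - v ∘ q3.
  apply: (kernel_lift ki); rewrite compBr !comp_assoc -def_w pv.
  by rewrite -!comp_assoc qa !comp_assoc subrr.
exists z; apply: im; rewrite !comp_assoc ixk iz compBl -!comp_assoc.
by rewrite jm (proj1 (proj1 s3)) comp0r subr0.
Qed.

(* Two morphisms with the same target are equalised, up to homotopy, by a common
   refinement of their sources. *)
Lemma chain_ore (C : abelian) (Z : C) (n : nat) (K1 K2 K : C)
    (c1 : chain Z n K1) (c2 : chain Z n K2) (c : chain Z n K) (f : Hom K1 K)
    (g : Hom K2 K) :
  cmor (idm Z) c1 c f -> cmor (idm Z) c2 c g ->
  exists (K' : C) (c' : chain Z n K') (u : Hom K' K1) (v : Hom K' K2),
    [/\ cmor (idm Z) c' c1 u, cmor (idm Z) c' c2 v & bd c' (f ∘ u - g ∘ v)].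
Proof.
elim: n K1 K2 K c1 c2 c f g => [|n IHn] K1 K2 K.
  move=> c1; elim/chain0_ind: K1 / c1 => c2; elim/chain0_ind: K2 / c2 => c.
  elim/chain0_ind: K / c => f g /= -> ->.
  by exists Z, (cnil Z), (idm Z), (idm Z); split=> //=; rewrite subrr.
move=> c1; elim/chainS_ind: K1 / c1 => L1 N1 P1 c1 j1 q1 s1.
move=> c2; elim/chainS_ind: K2 / c2 => L2 N2 P2 c2 j2 q2 s2.
move=> c; elim/chainS_ind: K / c => L N P c j q s f g /=.
move=> [f' [fP [fm jf qf]]] [g' [gP [gm jg qg]]].
have [L' [c' [u [v [c'c1 c'c2 h]]]]] := IHn _ _ _ _ _ _ _ _ fm gm.
have [L3 [c3 [l [h3 [c3c' bh3 qh3]]]]] := bd_lift (proj2 s) h.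
have [V [e [a [ee q1a]]]] := epi_lift (u ∘ l) (proj2 s1).
have [V' [e' [b [ee' q2b]]]] := epi_lift (v ∘ l ∘ e) (proj2 s2).
have [N' [j' s']] := ses_kernel_exists (epi_comp ee ee').
have [z0 _] := proj1 s'.
have [u' ju'] : exists u' : Hom N' N1, j1 ∘ u' = a ∘ e' ∘ j'.
  apply: (kernel_lift (proj1 s1)).
  by rewrite !comp_assoc q1a -!comp_assoc [e ∘ _]comp_assoc z0 !comp0r.
have [v' jv'] : exists v' : Hom N' N2, j2 ∘ v' = b ∘ j'.
  apply: (kernel_lift (proj1 s2)).
  by rewrite !comp_assoc q2b -!comp_assoc [e ∘ _]comp_assoc z0 !comp0r.
exists N', (csnoc c3 s'), u', v'; split.
- exists (u ∘ l), (a ∘ e'); split=> //; first exact: cmor_comp_id c3c' c'c1.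
  by rewrite comp_assoc q1a !comp_assoc.
- exists (v ∘ l), b; split=> //; first exact: cmor_comp_id c3c' c'c2.
  by rewrite q2b !comp_assoc.
(* [h3] lifts the homotopy of the shorter chains to [P]. After this correction the difference of the
   two lifts lands in [N]; the correction vanishes on [N']. *)
have [t jt] : exists t : Hom V' N,
    j ∘ t = fP ∘ (a ∘ e') - gP ∘ b - h3 ∘ (e ∘ e').
  apply: (kernel_lift (proj1 s)); rewrite !compBr !comp_assoc qf qg qh3.
  rewrite -[f' ∘ q1 ∘ a]comp_assoc q1a -[g' ∘ q2 ∘ b]comp_assoc q2b.
  by rewrite !compBl !comp_assoc subrr.
exists t; apply: (kernel_mono (proj1 s)).
rewrite comp_assoc jt !compBr !compBl !comp_assoc jf jg.
rewrite -!comp_assoc ju' jv' [e ∘ (e' ∘ _)]comp_assoc z0 comp0r subr0.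
by rewrite !comp_assoc.
Qed.

Lemma biproduct_ses (C : abelian) (S M N : C) (i1 : Hom M S) (i2 : Hom N S)
    (p1 : Hom S M) (p2 : Hom S N) :
  p1 ∘ i1 = idm M -> p2 ∘ i2 = idm N -> p2 ∘ i1 = 0 ->
  i1 ∘ p1 + i2 ∘ p2 = idm S -> ses i1 p2.
Proof.
move=> pi11 pi22 pi21 pid; split; last first.
  by move=> W u v /(congr1 (compm^~ i2)); rewrite -!comp_assoc pi22 !comp_idr.
apply: kernelP => //.
  by move=> W u v /(congr1 (compm p1)); rewrite !comp_assoc pi11 !comp_idl.
move=> W g p2g; exists (p1 ∘ g).
by rewrite -[g in RHS]comp_idl -pid compDl -!comp_assoc p2g !comp0r addr0.
Qed.

(** * Comparison with Yoneda Ext *)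

Definition cmap (C : abelian) (n : nat) (Z Y : C) : relation (chain Z n Y) :=
  fun c c' => cmor (idm Z) c c' (idm Y).

Definition chain_conn (C : abelian) (n : nat) (Z Y : C) : Prop :=
  forall c c' : chain Z n Y, clos_refl_sym_trans _ (@cmap C n Z Y) c c'.

(** The sequence 0 -> ... -> 0 -> Z = Z, weakly terminal among the chains of its length. *)
Lemma zero_chain_exists (C : abelian) (n : nat) (Z : C) :
  exists (T : C) (z : chain Z n T), forall (L : C) (c : chain Z n L),
    exists u : Hom L T, cmor (idm Z) c z u.
Proof.
elim: n => [|n [T [z hz]]].
  by exists Z, (cnil Z); apply: chain0_ind; exists (idm Z).
have [O hO] := ab_zero C.
have sO : ses (0 : Hom O T) (idm T).
  split; last exact: epi_idm.
  apply: kernelP; first by move=> W u v _; rewrite ((hO W).1 u) ((hO W).1 v).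
    exact: comp0r.
  by move=> W g; rewrite comp_idl => ->; exists 0; rewrite comp0l.
exists O, (csnoc z sO); apply: chainS_ind => K N P c j q s.
have [u cu] := hz K c; exists 0, u, (u ∘ q); split=> //; last by rewrite comp_idl.
by rewrite comp0l -comp_assoc (proj1 (proj1 s)) comp0r.
Qed.

(** The neutral class: [Y] is added as a direct summand to a weakly terminal chain, so every chain
    with a retraction onto [Y] maps to it. *)
Lemma split_chain_exists (C : abelian) (n : nat) (Z Y : C) :
  exists t : chain Z n.+1 Y, bd t (idm Y) /\
    forall (K Q : C) (c : chain Z n K) (i : Hom Y Q) (r : Hom Q K) (s : ses i r)
      (h : Hom Q Y), h ∘ i = idm Y -> cmap (csnoc c s) t.
Proof.
have [T [z hz]] := zero_chain_exists n Z.
have [S [i1 [i2 [p1 [p2 [pi11 pi22 pi12 pi21 pid]]]]]] := ab_biproduct Y T.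
have sS := biproduct_ses pi11 pi22 pi21 pid.
exists (csnoc z sS); split=> [|K Q c i r s h hi]; first by exists p1.
have [u cu] := hz K c; exists u, (i1 ∘ h + i2 ∘ (u ∘ r)); split=> //.
  by rewrite compDl -!comp_assoc hi (proj1 (proj1 s)) !comp0r addr0.
by rewrite compDr !comp_assoc pi21 pi22 comp0l add0r comp_idl.
Qed.

(** Turns a pair (chain, [x]) into an extension ending in [Y]. The last clause says that the pushout
    is initial among the extensions reached over [x], up to uniqueness. *)
Lemma chain_pushout (C : abelian) (n : nat) (Z L K P Y : C) (c : chain Z n L)
    (j : Hom K P) (q : Hom P L) (s : ses j q) (x : Hom K Y) :
  exists (Q : C) (i : Hom Y Q) (r : Hom Q L) (s' : ses i r),
    [/\ cmor (idm Z) (csnoc c s) (csnoc c s') x,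
        forall t : Hom P Y, x = t ∘ j -> exists h : Hom Q Y, h ∘ i = idm Y
      & forall d : chain Z n.+1 Y, cmor (idm Z) (csnoc c s) d x ->
          cmap (csnoc c s') d].
Proof.
have [Q [i [g [r [s' ix rg univ]]]]] := ses_pushout x s.
exists Q, i, r, s'; split.
- by exists (idm L), g; rewrite comp_idl; split=> //; apply: cmor_id.
- move=> t xt; have [h [hi _]] := univ Y (idm Y) t (etrans (comp_idl _) xt).
  by exists h.
move=> d; move: x ix univ s'; elim/chainS_ind: Y / d i => L' Y P' d j' q' t i.
move=> x ix univ s' [l [p [cd jx qp]]].
have [h [hi hg]] := univ P' j' p jx.
exists l, h; split=> //; first by rewrite hi comp_idr.
(* [univ] gives existence only, so the right-hand square must be checked: its defect kills [i],
   factors through [r] as [w], and dies on the epimorphism [q]. *)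
have [w def_w] : exists w : Hom L L', w ∘ r = q' ∘ h - l ∘ r.
  apply: (cokernel_desc (ses_cokernel s')).
  rewrite compBl -!comp_assoc hi (proj1 (proj1 t)) (proj1 (proj1 s')).
  by rewrite comp0r subrr.
have w0 : w = 0.
  apply: ((epi0P q).1 (proj2 s)).
  by rewrite -rg comp_assoc def_w compBl -!comp_assoc hg rg qp subrr.
by move: def_w; rewrite w0 comp0l => /esym/eqP; rewrite subr_eq0 => /eqP.
Qed.

(** The class of [x] on [c] equals that of [idm Y] on [d]. On a common refinement, [x ∘ u] differs
    from the coboundary [k ∘ v] by a coboundary. *)
Lemma bd_transfer (C : abelian) (n : nat) (Z K Y : C) (c : chain Z n K)
    (d : chain Z n Y) (x : Hom K Y) :
  cmor (idm Z) c d x ->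
  (exists (K' : C) (d' : chain Z n K') (k : Hom K' Y),
    cmor (idm Z) d' d k /\ bd d' k) ->
  exists (K' : C) (c' : chain Z n K') (k : Hom K' K),
    cmor (idm Z) c' c k /\ bd c' (x ∘ k).
Proof.
move=> cd [K' [d' [k [d'd bk]]]].
have [K'' [c' [u [v [c'c c'd' h]]]]] := chain_ore cd d'd.
exists K'', c', u; split=> //.
rewrite -[x ∘ u](subrK (k ∘ v)) -[k ∘ v in X in _ + X]opprK.
by apply: bdB => //; rewrite -compNl; apply: bd_pull c'd' _; rewrite -[k]comp_idl
  -compNl; apply: bd_push.
Qed.

(** If the class of [idm Y] on a chain dies on a refinement, the pushout of that refinement splits
    and maps both to the given chain and to the split one. Conversely, vanishing is constant along
    zigzags and holds for the split chain. *)
Lemma evan_chain_conn (C : abelian) (n : nat) (Z Y : C) :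
  evan n.+1 Z Y <-> chain_conn n.+1 Z Y.
Proof.
have [t [bt ht]] := split_chain_exists n Z Y.
split=> [v c c'|conn K c x].
  suff ct d : clos_refl_sym_trans _ (@cmap C n.+1 Z Y) d t.
    exact: rst_trans (ct c) (rst_sym _ _ _ _ (ct c')).
  have [K [d' [k [d'd]]]] := v Y d (idm Y); rewrite comp_idl.
  elim/chainS_ind: K / d' k d'd => L K P d' j q s k d'd /= [y ky].
  have [Q [i [r [s' [_ split_s' push]]]]] := chain_pushout d' s k.
  have [h hi] := split_s' y ky.
  apply: rst_trans (rst_step _ _ _ _ (ht _ _ d' i r s' h hi)).
  exact/rst_sym/rst_step/push.
elim/chainS_ind: K / c x => L K P c j q s x.
have [Q [i [r [s' [cc' _ _]]]]] := chain_pushout c s x.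
apply: (bd_transfer cc').
(* The class of [d] itself, represented by [idm Y], vanishes. *)
pose null d := exists (K' : C) (d' : chain Z n.+1 K') (k : Hom K' Y),
  cmor (idm Z) d' d k /\ bd d' k.
have step d d' : cmap d d' -> null d <-> null d'.
  move=> dd'; split=> [[K' [e [k [ed be]]]]|/(bd_transfer dd')].
    by exists K', e, k; split=> //; rewrite -[k]comp_idl; apply: cmor_comp_id ed dd'.
  by move=> [K' [e [k [ed]]]]; rewrite comp_idl; exists K', e, k.
suff /(_ _ _ (conn (csnoc c s') t)) [_] : forall d d',
    clos_refl_sym_trans _ (@cmap C n.+1 Z Y) d d' -> null d <-> null d'.
  by apply; exists Y, t, (idm Y); split=> //; apply: cmor_id.
by move=> d d'; elim=> [||d1 d2 _ []|d1 d2 d3 _ [? ?] _ [? ?]]; [exact: step|..];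
  split; auto.
Qed.

Lemma exact_epi_cancel (C : abelian) (W X Y Z : C) (f : Hom X Y) (g : Hom Y Z)
    (e : Hom W X) :
  is_epi e -> exact (f ∘ e) g -> exact f g.
Proof.
move=> ee [I [i [[Q [p [cp kp]]] ki]]]; exists I, i; split=> //.
by exists Q, p; split=> //; apply: (cokernel_comp_epi p f ee).2.
Qed.

Definition aug_hom (C : preadditive) (P L : C) (q : Hom P L) (O O' : nat -> C)
    (f : forall k, Hom (O k) (O' k)) (k : nat) : Hom (aug P O k) (aug L O' k) :=
  match k with 0%N => q | i.+1 => f i end.

(** [aug P O k] and [aug L O k] differ at [k = 0] only; this comparison map keeps the splicing
    uniform in [k]. *)
Definition aug_step (C : preadditive) (P L : C) (q : Hom P L) (O : nat -> C) :
    forall k : nat, Hom (aug P O k) (aug L O k) :=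
  aug_hom q (fun i => idm (O i)).

(* Splices N -j-> P -q-> L with L -> O 0 -> O 1 -> ... *)
Definition cons_map (C : preadditive) (N P L : C) (j : Hom N P) (q : Hom P L)
    (O : nat -> C) (f : forall k, Hom (aug L O k) (O k)) (k : nat) :
    Hom (aug N (aug P O) k) (aug P O k) :=
  match k with 0%N => j | i.+1 => f i ∘ aug_step q O i end.

(* Replaces M -> O 0 -> O 1 by a monomorphism K -> O 1. *)
Definition tail_map (C : preadditive) (M K : C) (O : nat -> C)
    (f : forall k, Hom (aug M O k) (O k)) (i : Hom K (O 1%N)) (k : nat) :
    Hom (aug K (fun n => O n.+1) k) (O k.+1) :=
  match k with 0%N => i | k'.+1 => f k'.+2 end.

Lemma epi_aug_step (C : preadditive) (P L : C) (q : Hom P L) (O : nat -> C) k :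
  is_epi q -> is_epi (aug_step q O k).
Proof. by case: k => [|k] // _; apply: epi_idm. Qed.

Lemma aug_step_hom (C : preadditive) (P L P' L' : C) (q : Hom P L)
    (q' : Hom P' L') (p : Hom P P') (l : Hom L L') (O O' : nat -> C)
    (f : forall k, Hom (O k) (O' k)) k :
  q' ∘ p = l ∘ q ->
  aug_step q' O' k ∘ aug_hom p f k = aug_hom l f k ∘ aug_step q O k.
Proof. by case: k => [|k] //= _; rewrite comp_idl comp_idr. Qed.

Section ConsTail.

Variable C : abelian.

Lemma cons_map_exact0 (N P L : C) (j : Hom N P) (q : Hom P L) (O : nat -> C)
    (f : forall k, Hom (aug L O k) (O k)) :
  ses j q -> is_mono (f 0%N) -> exact (cons_map j q f 0) (cons_map j q f 1).
Proof.
by move=> /short_exactP[_ ex _] fm; apply: exact_mono_comp ex.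
Qed.

Lemma cons_map_exact (N P L : C) (j : Hom N P) (q : Hom P L) (O : nat -> C)
    (f : forall k, Hom (aug L O k) (O k)) k :
  is_epi q -> exact (f k) (f k.+1) ->
  exact (cons_map j q f k.+1) (cons_map j q f k.+2).
Proof.
move=> qe ex /=; rewrite comp_idr; apply: exact_comp_epi ex.
exact: epi_aug_step.
Qed.

Lemma tail_map_ses (M K : C) (O : nat -> C)
    (f : forall k, Hom (aug M O k) (O k)) (i : Hom K (O 1%N)) (e : Hom (O 0%N) K) :
  is_mono (f 0%N) -> exact (f 0%N) (f 1%N) -> is_mono i -> is_epi e ->
  f 1%N = i ∘ e -> ses (f 0%N) e.
Proof.
move=> fm ex im ee f1; split=> //.
have := mono_exact_kernel fm ex; rewrite f1 => kf.
exact: ((@cokernel_comp_epi (opp C) _ _ _ _ (f 0%N) e i im).2 kf).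
Qed.

Lemma tail_map_exact (M K : C) (O : nat -> C)
    (f : forall k, Hom (aug M O k) (O k)) (i : Hom K (O 1%N)) (e : Hom (O 0%N) K)
    k :
  is_epi e -> f 1%N = i ∘ e -> exact (f k.+1) (f k.+2) ->
  exact (tail_map f i k) (tail_map f i k.+1).
Proof. by case: k => [|k] // ee /= ->; apply: exact_epi_cancel. Qed.

End ConsTail.

(** The terms P_n, ..., P_1 in the order used by [yext]; from index [n] on, the default value is
    [Z]. *)
Fixpoint cobj (C : abelian) (Z : C) (n : nat) (K : C) (c : chain Z n K) :
    nat -> C :=
  match c with
  | cnil => fun _ => Z
  | csnoc _ _ _ P c0 _ _ _ => aug P (cobj c0)
  end.

Fixpoint cdiff (C : abelian) (Z : C) (n : nat) (K : C) (c : chain Z n K) :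
    forall k, Hom (aug K (cobj c) k) (cobj c k) :=
  match c as c0 in chain _ _ K0
    return forall k, Hom (aug K0 (cobj c0) k) (cobj c0 k) with
  | cnil => fun k => match k with 0%N => idm Z | _.+1 => idm Z end
  | csnoc _ _ _ _ c0 j q _ => cons_map j q (cdiff c0)
  end.

Fixpoint cepi (C : abelian) (Z : C) (n : nat) (K : C) (c : chain Z n K) :
    Hom (aug K (cobj c) n) Z :=
  match c as c0 in chain _ n0 K0 return Hom (aug K0 (cobj c0) n0) Z with
  | cnil => idm Z
  | csnoc n0 _ _ _ c0 _ q _ => cepi c0 ∘ aug_step q (cobj c0) n0
  end.

Lemma cdiff_mono (C : abelian) (Z : C) (n : nat) (K : C) (c : chain Z n K) :
  is_mono (cdiff c 0).
Proof.
case: c => [|m L N P c j q s] /=; first exact: mono_idm.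
exact: kernel_mono (proj1 s).
Qed.

Arguments cdiff_mono {C Z n K} c [W] g h.

Lemma cepi_epi (C : abelian) (Z : C) (n : nat) (K : C) (c : chain Z n K) :
  is_epi (cepi c).
Proof.
elim: c => [|m L N P c IHc j q [_ qe]] /=; first exact: epi_idm.
by apply: epi_comp => //; apply: epi_aug_step.
Qed.

Arguments cepi_epi {C Z n K} c [W] g h.

Lemma cdiff_exact (C : abelian) (Z : C) (n : nat) (K : C) (c : chain Z n K) k :
  (k.+1 < n)%N -> exact (cdiff c k) (cdiff c k.+1).
Proof.
elim: c k => // m L N P c IHc j q s [_|k].
  exact: (cons_map_exact0 (f := cdiff c) s (cdiff_mono c)).
by rewrite ltnS => /IHc; apply: (@cons_map_exact _ _ _ _ j q _ (cdiff c)); case: s.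
Qed.

Lemma cepi_exact (C : abelian) (Z : C) (n : nat) (K : C) (c : chain Z n.+1 K) :
  exact (cdiff c n) (cepi c).
Proof.
elim: n K c => [|n IHn] K c; elim/chainS_ind: K / c => L N P c j q s.
  elim/chain0_ind: L / c q s => q s /=; rewrite comp_idl.
  by have /short_exactP[] := s.
rewrite /= comp_idr; have := IHn _ c; apply: exact_comp_epi.
by apply: epi_aug_step; case: s.
Qed.

Definition chain_yext (C : abelian) (m : nat) (Z Y : C) (c : chain Z m.+1 Y) :
    yext m Z Y :=
  YExt (cdiff_mono c) (fun k lt_km => @cdiff_exact C Z m.+1 Y c k lt_km)
    (cepi_exact c) (cepi_epi c).

(** The components at the cut points are not extra data: each cut point is a cokernel, so its
    component is induced by those on the terms. *)
Lemma cmor_hom (C : abelian) (Z : C) (n : nat) (K K' : C) (c : chain Z n K)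
    (c' : chain Z n K') (y : Hom K K') :
  cmor (idm Z) c c' y <->
  exists phi : forall k, Hom (cobj c k) (cobj c' k),
    (forall k, (k < n)%N ->
      phi k ∘ cdiff c k = cdiff c' k ∘ aug_hom y phi k) /\
    cepi c' ∘ aug_hom y phi n = cepi c.
Proof.
elim: n K K' c c' y => [|n IHn] K K' c.
  elim/chain0_ind: K / c => c'; elim/chain0_ind: K' / c' => y /=.
  rewrite comp_idl; split=> [->|[_ [_ ->]]] //.
  by exists (fun _ => 0).
elim/chainS_ind: K / c => L N P c j q s c'.
elim/chainS_ind: K' / c' => L' N' P' c' j' q' s' y /=.
split=> [[l [p [/IHn[phi [hphi ephi]] jy qp]]]|[phi [hphi ephi]]].
  exists (aug_hom p phi); split=> [[|k] /=|]; first by rewrite jy.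
    rewrite ltnS => /hphi; rewrite comp_assoc => ->.
    by rewrite -!comp_assoc (aug_step_hom _ _ qp).
  by rewrite -comp_assoc (aug_step_hom _ _ qp) comp_assoc ephi.
have jy : j' ∘ y = phi 0%N ∘ j by rewrite (hphi 0%N).
have [l lq] : exists l : Hom L L', l ∘ q = q' ∘ phi 0%N.
  apply: (cokernel_desc (ses_cokernel s)).
  by rewrite -comp_assoc -jy comp_assoc (proj1 (proj1 s')) comp0l.
exists l, (phi 0%N); split=> //; apply/IHn.
have phiE k : aug_hom y phi k.+1 = aug_hom (phi 0%N) (fun i => phi i.+1) k.
  by case: k.
exists (fun k => phi k.+1); split=> [k lt_kn|].
  apply: (epi_aug_step (O := cobj c) (k := k) (proj2 s)).
  have := hphi k.+1 lt_kn; rewrite phiE /= -!comp_assoc => ->.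
  by rewrite (aug_step_hom _ _ (esym lq)).
apply: (epi_aug_step (O := cobj c) (k := n) (proj2 s)).
have := ephi; rewrite -[phi n]/(aug_hom y phi n.+1) phiE -!comp_assoc => <-.
by rewrite (aug_step_hom _ _ (esym lq)).
Qed.

Lemma chain_yext_mor (C : abelian) (m : nat) (Z Y : C) (c c' : chain Z m.+1 Y) :
  cmap c c' <-> yext_mor (chain_yext c) (chain_yext c').
Proof.
rewrite /cmap cmor_hom; split=> [[phi [hphi ephi]]|[phi [h0 hphi ephi]]].
  exists phi; split=> // [|k lt_km]; last exact: hphi.
  by have := hphi 0%N isT; rewrite /= comp_idr.
exists phi; split=> // -[_|k]; last exact: hphi.
by rewrite /= comp_idr; exact: h0.
Qed.

Lemma yext_mor_refl (C : abelian) (m : nat) (Z Y : C) (E : yext m Z Y) :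
  yext_mor E E.
Proof.
exists (fun k => idm _); split=> [|k _|]; rewrite ?comp_idl ?comp_idr //.
Qed.

Lemma yext_mor_trans (C : abelian) (m : nat) (Z Y : C) (E F G : yext m Z Y) :
  yext_mor E F -> yext_mor F G -> yext_mor E G.
Proof.
move=> [phi [a b c]] [psi [a' b' c']]; exists (fun k => psi k ∘ phi k).
split=> [|k lt_km|]; first by rewrite -comp_assoc a.
  by rewrite -comp_assoc b // comp_assoc b' // comp_assoc.
by rewrite comp_assoc c'.
Qed.

(** Values of [E] beyond index [m] are arbitrary, so [E] cannot be recovered as an equal extension;
    morphisms both ways are enough for the equivalence. The chain cuts [E] at the image of its
    second map. *)
Lemma yext_chain (C : abelian) (m : nat) (Z Y : C) (E : yext m Z Y) :
  exists c : chain Z m.+1 Y,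
    yext_mor E (chain_yext c) /\ yext_mor (chain_yext c) E.
Proof.
elim: m Y E => [|m IHm] Y [O f p fm fex fexl pe].
  have s : ses (f 0%N) p by split=> //; apply: mono_exact_kernel.
  exists (csnoc (cnil Z) s).
  pose O' := aug (O 0%N) (fun _ => Z).
  split.
    exists (fun k => match k return Hom (O k) (O' k) with
                     | 0%N => idm (O 0%N) | _ => 0 end).
    by split=> //=; rewrite ?comp_idl ?comp_idr.
  exists (fun k => match k return Hom (O' k) (O k) with
                   | 0%N => idm (O 0%N) | _ => 0 end).
  by split=> //=; rewrite ?comp_idl ?comp_idr.
have [K [i iim]] := ex_image (f 1%N).
have [im [e ee f1]] := (imageP _ _).1 iim.
have s : ses (f 0%N) e := tail_map_ses fm (fex 0%N isT) im ee f1.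
have tex k : (k < m)%N -> exact (tail_map f i k) (tail_map f i k.+1).
  by move=> lt_km; apply: tail_map_exact ee f1 _; apply: fex.
have texl : exact (tail_map f i m) p.
  case: m p fexl {pe IHm fex tex} => //= p; rewrite f1.
  exact: exact_epi_cancel.
have [c [[phi [a1 b1 c1]] [psi [a2 b2 c2]]]] :=
  IHm K (@YExt C m Z K (fun k => O k.+1) (tail_map f i) p im tex texl pe).
exists (csnoc c s); pose O' := aug (O 0%N) (cobj c); split.
  exists (fun k => match k return Hom (O k) (O' k) with
                   | 0%N => idm (O 0%N) | k'.+1 => phi k' end).
  split=> [|[_|k lt_km]|] /=; first exact: comp_idl.
  - by rewrite comp_idr f1 comp_assoc a1.
  - by rewrite !comp_idr; exact: b1 lt_km.
  by rewrite comp_idr.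
exists (fun k => match k return Hom (O' k) (O k) with
                 | 0%N => idm (O 0%N) | k'.+1 => psi k' end).
split=> [|[_|k lt_km]|] /=; first exact: comp_idl.
- by rewrite comp_idr f1 comp_assoc a2.
- by rewrite !comp_idr; exact: b2 lt_km.
by rewrite comp_idr.
Qed.

Lemma ext_zero_chain_conn (C : abelian) (m : nat) (Z Y : C) :
  ext_zero m.+1 Z Y <-> chain_conn m.+1 Z Y.
Proof.
split=> [ext c c'|conn E E'].
  have /= := ext (chain_yext c) (chain_yext c').
  (* Intermediate extensions of a zigzag need not come from chains, so the induction quantifies over
     all chains next to its two ends. *)
  suff h E E' : yext_equiv E E' -> forall c c' : chain Z m.+1 Y,
      yext_mor (chain_yext c) E -> yext_mor E' (chain_yext c') ->
      clos_refl_sym_trans _ (@cmap C m.+1 Z Y) c c'.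
    by move/h; apply; apply: yext_mor_refl.
  elim=> {E E' c c'} [E E' EE' c c' cE E'c'|E c c' cE Ec'|E E' _ IH|E F G _ IH1 _ IH2].
  - apply/rst_step/chain_yext_mor.
    exact: yext_mor_trans cE (yext_mor_trans EE' E'c').
  - by apply/rst_step/chain_yext_mor/(yext_mor_trans cE Ec').
  - move=> c c' cE' Ec'; have [d [Ed dE]] := yext_chain E.
    have [d' [E'd' d'E']] := yext_chain E'.
    have st a b F : yext_mor (chain_yext a) F -> yext_mor F (chain_yext b) ->
        clos_refl_sym_trans _ (@cmap C m.+1 Z Y) a b.
      by move=> aF Fb; apply/rst_step/chain_yext_mor/(yext_mor_trans aF Fb).
    apply: rst_trans (st _ _ _ cE' E'd') _.
    apply: rst_trans (rst_sym _ _ _ _ (IH d d' dE E'd')) _.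
    exact: st dE Ec'.
  - move=> c c' cE Gc'; have [d [Fd dF]] := yext_chain F.
    exact: rst_trans (IH1 c d cE Fd) (IH2 d c' dF Gc').
have [c [Ec _]] := yext_chain E; have [c' [_ c'E']] := yext_chain E'.
apply: rst_trans (rst_step _ _ _ _ Ec) _.
apply: rst_trans (rst_step _ _ _ _ c'E').
elim: (conn c c') => [a b /chain_yext_mor ab|a|a b _ IH|a b d _ IH1 _ IH2].
- exact: rst_step.
- exact: rst_refl.
- exact: rst_sym.
- exact: rst_trans IH1 IH2.
Qed.

Lemma ext_zero_evan (C : abelian) (m : nat) (Z Y : C) :
  ext_zero m.+1 Z Y <-> evan m.+1 Z Y.
Proof. by rewrite evan_chain_conn ext_zero_chain_conn. Qed.

(** * Ext in the opposite category *)

(** [csnoc] lengthens a chain away from [Z]; reversal needs lengthening at the [Z] end. *)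
Fixpoint ccons (C : abelian) (K N P : C) (j : Hom N P) (q : Hom P K)
    (s : ses j q) (n : nat) (Y : C) (c : chain N n Y) : chain K n.+1 Y :=
  match c in chain _ n0 Y0 return chain K n0.+1 Y0 with
  | cnil => csnoc (cnil K) s
  | csnoc _ _ _ _ c0 _ _ s0 => csnoc (ccons s c0) s0
  end.

Lemma ccons_mor (C : abelian) (K N P K' N' P' : C) (j : Hom N P) (q : Hom P K)
    (s : ses j q) (j' : Hom N' P') (q' : Hom P' K') (s' : ses j' q')
    (n : nat) (Y Y' : C) (c : chain N n Y) (c' : chain N' n Y') (z : Hom K K')
    (p : Hom P P') (l : Hom N N') (y : Hom Y Y') :
  cmor l c c' y -> j' ∘ l = p ∘ j -> q' ∘ p = z ∘ q ->
  cmor z (ccons s c) (ccons s' c') y.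
Proof.
move=> + jl qp; elim: n Y Y' c c' y => [|n IHn] Y Y' c c' y.
  elim/chain0_ind: Y / c y; elim/chain0_ind: Y' / c' => y /= ->.
  by exists z, p.
elim/chainS_ind: Y / c y => L M Q c j0 q0 s0.
elim/chainS_ind: Y' / c' => L' M' Q' c' j1 q1 s1 y /=.
by move=> [l' [p' [/IHn ? ? ?]]]; exists l', p'.
Qed.

(** Reversal is defined twice, here and as [oppc], because [opp (opp C)] does not compute to [C]. *)
Fixpoint crev (C : abelian) (Y : C) (n : nat) (Z : C)
    (c : @chain (opp C) Y n Z) : @chain C Z n Y :=
  match c in chain _ n0 Z0 return @chain C Z0 n0 Y with
  | cnil => @cnil C Y
  | csnoc _ _ _ _ c0 _ _ s => ccons (opp_ses_inv s) (crev c0)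
  end.

Fixpoint oppc (C : abelian) (Y : C) (n : nat) (Z : C) (c : @chain C Y n Z) :
    @chain (opp C) Z n Y :=
  match c in chain _ n0 Z0 return @chain (opp C) Z0 n0 Y with
  | cnil => @cnil (opp C) Y
  | csnoc _ _ _ _ c0 _ _ s => ccons (opp_ses s) (oppc c0)
  end.

Lemma crev_ccons (C : abelian) (K N P : opp C) (j : Hom N P) (q : Hom P K)
    (s : ses j q) (n : nat) (Y : opp C) (c : chain N n Y) :
  crev (ccons s c) = csnoc (crev c) (opp_ses_inv s).
Proof. by elim: c => //= m L M Q c IHc j0 q0 s0; rewrite IHc. Qed.

Lemma oppc_ccons (C : abelian) (K N P : C) (j : Hom N P) (q : Hom P K)
    (s : ses j q) (n : nat) (Y : C) (c : chain N n Y) :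
  oppc (ccons s c) = csnoc (oppc c) (opp_ses s).
Proof. by elim: c => //= m L M Q c IHc j0 q0 s0; rewrite IHc. Qed.

Lemma oppcK (C : abelian) (Y : C) (n : nat) (Z : C) (c : chain Y n Z) :
  crev (oppc c) = c.
Proof.
elim: c => //= m L M Q c IHc j q s; rewrite crev_ccons IHc.
by congr csnoc; apply: Prop_irrelevance.
Qed.

Lemma crevK (C : abelian) (Y : opp C) (n : nat) (Z : opp C) (c : chain Y n Z) :
  oppc (crev c) = c.
Proof.
elim: c => //= m L M Q c IHc j q s; rewrite oppc_ccons IHc.
by congr csnoc; apply: Prop_irrelevance.
Qed.

Lemma crev_mor (C : abelian) (n : nat) (Y Y' Z Z' : opp C) (y : Hom Y Y')
    (z : Hom Z Z') (c : chain Y n Z) (c' : chain Y' n Z') :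
  cmor y c c' z -> @cmor C Z' Z z n Y' (crev c') Y (crev c) y.
Proof.
elim: n Z Z' z c c' => [|n IHn] Z Z' z c c'.
  elim/chain0_ind: Z / c z => z; elim/chain0_ind: Z' / c' z => z /= ->.
  by [].
elim/chainS_ind: Z / c z => L M Q c j0 q0 s0.
elim/chainS_ind: Z' / c' => L' M' Q' c' j1 q1 s1 z /=.
move=> [l [p [/IHn h jz qp]]].
by apply: ccons_mor h _ _; [exact: esym qp|exact: esym jz].
Qed.

Lemma oppc_mor (C : abelian) (n : nat) (Y Y' Z Z' : C) (y : Hom Y Y')
    (z : Hom Z Z') (c : chain Y n Z) (c' : chain Y' n Z') :
  cmor y c c' z -> @cmor (opp C) Z' Z z n Y' (oppc c') Y (oppc c) y.
Proof.
elim: n Z Z' z c c' => [|n IHn] Z Z' z c c'.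
  elim/chain0_ind: Z / c z => z; elim/chain0_ind: Z' / c' z => z /= ->.
  by [].
elim/chainS_ind: Z / c z => L M Q c j0 q0 s0.
elim/chainS_ind: Z' / c' => L' M' Q' c' j1 q1 s1 z /=.
move=> [l [p [/IHn h jz qp]]].
by apply: ccons_mor h _ _; [exact: esym qp|exact: esym jz].
Qed.

(** Reversal turns morphisms around, which the symmetric closure absorbs. *)
Lemma chain_conn_opp (C : abelian) (n : nat) (Z Y : C) :
  @chain_conn (opp C) n Y Z <-> @chain_conn C n Z Y.
Proof.
split=> conn c c'.
  rewrite -[c]oppcK -[c']oppcK.
  elim: (conn (oppc c) (oppc c')) => [a b ab|a|a b _ IH|a b d _ IH1 _ IH2].
  - exact/rst_sym/rst_step/(crev_mor ab).
  - exact: rst_refl.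
  - exact: rst_sym.
  - exact: rst_trans IH1 IH2.
rewrite -[c]crevK -[c']crevK.
elim: (conn (crev c) (crev c')) => [a b ab|a|a b _ IH|a b d _ IH1 _ IH2].
- exact/rst_sym/rst_step/(oppc_mor ab).
- exact: rst_refl.
- exact: rst_sym.
- exact: rst_trans IH1 IH2.
Qed.

Lemma ext_zero_opp (C : abelian) (k : nat) (Z Y : C) :
  @ext_zero (opp C) k Y Z <-> @ext_zero C k Z Y.
Proof.
by case: k => [|k] //; rewrite !ext_zero_chain_conn chain_conn_opp.
Qed.

(** * Half exactness and splitting for Yoneda Ext *)

Lemma ext_zero_ses3 (C : abelian) (n : nat) (Z K Y W : C) (i : Hom K Y)
    (p : Hom Y W) :
  ses i p -> ext_zero n.+1 Z Y -> ext_zero n.+2 Z K -> ext_zero n.+1 Z W.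
Proof. by rewrite !ext_zero_evan; apply: evan_ses3. Qed.

Lemma ext_zero_ses1 (C : abelian) (n : nat) (Z K Y W : C) (i : Hom K Y)
    (p : Hom Y W) :
  ses i p -> ext_zero n.+1 Z W -> ext_zero n.+2 Z Y -> ext_zero n.+2 Z K.
Proof. by rewrite !ext_zero_evan; apply: evan_ses1. Qed.

Lemma ext_zero_ses1_left (C : abelian) (n : nat) (Z K Y W : C) (i : Hom K Y)
    (p : Hom Y W) :
  ses i p -> ext_zero n.+1 Y Z -> ext_zero n.+2 W Z -> ext_zero n.+1 K Z.
Proof.
move=> /opp_ses s /ext_zero_opp vY /ext_zero_opp vW; apply/ext_zero_opp.
exact: ext_zero_ses3 s vY vW.
Qed.

(** Vanishing is applied to [idm K], which extends only after a refinement [a] of [Y]. The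
    correction [a - i ∘ h] descends to a section [u] of [p]. *)
Lemma ext1_split (C : abelian) (K Y W : C) (i : Hom K Y) (p : Hom Y W) :
  ses i p -> ext_zero 1 W K -> is_biproduct Y K W.
Proof.
move=> s /ext_zero_evan v; have [ki pe] := s; have im := kernel_mono ki.
have [N [c' [k [c'c]]]] := v K (csnoc (cnil W) s) (idm K).
rewrite comp_idl; elim/chainS_ind: N / c' k c'c => L N P d j q t k /=.
elim/chain0_ind: L / d q t => q t [l [a [-> jk qa]]] [h kh].
rewrite comp_idl in qa.
have [u uq] : exists u : Hom W Y, u ∘ q = a - i ∘ h.
  apply: (cokernel_desc (ses_cokernel t)).
  by rewrite compBl -comp_assoc -kh jk subrr.
have pu : p ∘ u = idm W.
  apply: (proj2 t); rewrite -comp_assoc uq compBr comp_assoc (proj1 ki) comp0l.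
  by rewrite subr0 qa comp_idl.
have [r ir] : exists r : Hom Y K, i ∘ r = idm Y - u ∘ p.
  apply: (kernel_lift ki).
  by rewrite compBr comp_assoc pu comp_idl comp_idr subrr.
exists i, u, r, p; split=> //; last by rewrite ir subrK.
- apply: im; rewrite comp_assoc ir compBl -comp_assoc (proj1 ki).
  by rewrite comp0r subr0 comp_idl comp_idr.
- apply: im; rewrite comp_assoc ir compBl -comp_assoc pu comp0r.
  by rewrite comp_idl comp_idr subrr.
- exact: (proj1 ki).
Qed.

(** * Coresolutions and relative dimensions *)

Lemma enat_eqP (x y : enat) :
  (forall n, le_enat x (Fin n) <-> le_enat y (Fin n)) -> x = y.
Proof.
case: x y => [m|] [n|] //= h.
- by congr Fin; apply/eqP; rewrite eqn_leq; apply/andP; split; apply/h.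
- by have /h := leqnn m.
- by have /h := leqnn n.
Qed.

Lemma neq_Infty (x : enat) : x <> Infty <-> exists n, le_enat x (Fin n).
Proof.
case: x => [m|]; split=> //; last by case.
by exists m => /=.
Qed.

(** [P] need not be upward closed, hence the smaller witness: a coresolution cannot always be
    lengthened. *)
Lemma min_enat_le (P : nat -> Prop) (n : nat) :
  le_enat (min_enat P) (Fin n) <-> exists m, (m <= n)%N /\ P m.
Proof.
rewrite /min_enat; case: pselect => [ex_P|no_P] /=; last first.
  by split=> // -[m [_ Pm]]; apply: no_P; exists m; apply/asboolP.
case: ex_minnP => m /asboolP Pm min_m; split=> [le_mn|[k [le_kn /asboolP Pk]]].
  by exists m.
exact: leq_trans (min_m _ Pk) le_kn.
Qed.

Lemma sup_enat_le (T : Type) (D : set T) (h : T -> enat) (n : nat) :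
  le_enat (sup_enat D h) (Fin n) <-> forall M, D M -> le_enat (h M) (Fin n).
Proof.
rewrite min_enat_le; split=> [[m [le_mn hm]] M /hm|hn]; last by exists n.
by case: (h M) => //= k /leq_trans; apply.
Qed.

Section ClassDimensions.

Variable C : abelian.
Implicit Types P Q Z D : set C.

Lemma projd_class_le Z D n :
  le_enat (projd_class Z D) (Fin n) <->
  forall M W k, D M -> Z W -> (n <= k)%N -> ext_zero k.+1 M W.
Proof.
rewrite sup_enat_le; split=> [h M W k DM ZW le_nk|h M DM].
  have /min_enat_le[m [le_mn hm]] := h M DM.
  by apply: hm => //; rewrite ltnS (leq_trans le_mn).
by apply/min_enat_le; exists n; split=> // -[|k] W // lt_nk ZW; apply: h.
Qed.

Lemma injd_class_le Z D n :
  le_enat (injd_class Z D) (Fin n) <->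
  forall M W k, D M -> Z W -> (n <= k)%N -> ext_zero k.+1 W M.
Proof.
rewrite sup_enat_le; split=> [h M W k DM ZW le_nk|h M DM].
  have /min_enat_le[m [le_mn hm]] := h M DM.
  by apply: hm => //; rewrite ltnS (leq_trans le_mn).
by apply/min_enat_le; exists n; split=> // -[|k] W // lt_nk ZW; apply: h.
Qed.

Lemma coresdim_class_le P Q D n :
  le_enat (coresdim_class P Q D) (Fin n) <->
  forall M, D M -> exists m, (m <= n)%N /\ has_coresolution P Q m M.
Proof. by rewrite sup_enat_le; split=> h M /h/min_enat_le. Qed.

Lemma has_coresolution0 P Q (M : C) :
  has_coresolution P Q 0 M <->
  exists (W : C) (f : Hom M W), [/\ is_iso f, P W & Q W].
Proof.
split=> [[Qs [f [[fm _ fe] [[PW QW] _ _]]]]|[W [f [fiso PW QW]]]].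
  by exists (Qs 0%N), (f 0%N); split=> //; apply: mono_epi_iso.
exists (fun _ => W), (fun k => match k return Hom (aug M (fun _ => W) k) W with
  | 0%N => f | _.+1 => idm W end).
split; split=> //; [exact: iso_mono|exact: iso_epi|].
by move=> [|i].
Qed.

(** [P K] is asked for [0 < n] only, since [f 1] is an inner map only in length above 1. For
    [n = 0], [K] is merely isomorphic to a last term in [P], and [P] need not be closed under
    isomorphism. *)
Lemma has_coresolutionS P Q n (M : C) :
  has_coresolution P Q n.+1 M <->
  exists (W K : C) (i : Hom M W) (p : Hom W K),
    [/\ ses i p, Q W, (0 < n)%N -> P K & has_coresolution P Q n K].
Proof.
split.
  move=> [O [f [[fm fex fe] [PQn QO imP]]]].
  have [K [i [/imageP[im [e ee f1]] PK]]] : exists (K : C) (i : Hom K (O 1%N)),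
      is_image i (f 1%N) /\ ((0 < n)%N -> P K).
    case: (posnP n) => [_|n0].
      by have [K [i iim]] := ex_image (f 1%N); exists K, i.
    by have [K [i [iim PK]]] := imP 1%N n0; exists K, i.
  exists (O 0%N), K, (f 0%N), e; split=> //; last first.
  - exists (fun k => O k.+1), (tail_map f i); split; split=> //.
    + by move=> k lt_kn; apply: tail_map_exact ee f1 _; apply: fex.
    + case: n fe {fex PQn QO imP PK} => //=; rewrite f1 => fe W u v uv.
      by apply: fe; rewrite !comp_assoc uv.
    + by move=> k lt_kn; apply: QO.
    by move=> [|k] // /(imP k.+2).
  - exact: QO.
  exact: tail_map_ses fm (fex 0%N isT) im ee f1.
move=> [W [K [i [p [s QW PK [O [f [[fm fex fe] [PQn QO imP]]]]]]]]].
have pe := proj2 s.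
exists (aug W O), (cons_map i p f); split; split=> //.
- exact: kernel_mono (proj1 s).
- move=> [_|k lt_kn]; first exact: cons_map_exact0.
  by apply: cons_map_exact => //; apply: fex.
- by apply: epi_comp => //; apply: epi_aug_step.
- by move=> [|k] // lt_kn; apply: QO.
move=> [|[|k]] // lt_kn /=.
  exists K, (f 0%N); split; last exact: PK.
  by apply/imageP; split=> //; exists p.
have [I [j [jim PI]]] := imP k.+1 lt_kn; exists I, j; split=> //.
by rewrite comp_idr.
Qed.

Lemma has_coresolution_mono P P' Q Q' n (M : C) :
  P `<=` P' -> Q `<=` Q' -> has_coresolution P Q n M -> has_coresolution P' Q' n M.
Proof.
move=> PP' QQ'; elim: n M => [|n IHn] M.
  by move=> /has_coresolution0[W [f [? /PP' ? /QQ' ?]]];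
     apply/has_coresolution0; exists W, f.
move=> /has_coresolutionS[W [K [i [p [s /QQ' ? PK /IHn ?]]]]].
by apply/has_coresolutionS; exists W, K, i, p; split=> // /PK/PP'.
Qed.

Lemma ext_zero_iso k (Z Y Y' : C) (y : Hom Y Y') :
  is_iso y -> ext_zero k.+1 Z Y' -> ext_zero k.+1 Z Y.
Proof.
move=> [g [gy _]]; rewrite !ext_zero_evan => v K c x.
have [K' [c' [l [c'c b]]]] := v K c (y ∘ x); exists K', c', l; split=> //.
by rewrite -[x]comp_idl -gy -[g ∘ y ∘ x]comp_assoc -comp_assoc; apply: bd_push.
Qed.

End ClassDimensions.

Lemma ext_zero_iso_left (C : abelian) k (Z Z' Y : C) (z : Hom Z Z') :
  is_iso z -> ext_zero k.+1 Z' Y -> ext_zero k.+1 Z Y.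
Proof.
move=> /opp_iso [z' [? ?]] /ext_zero_opp v; apply/ext_zero_opp.
by apply: (@ext_zero_iso (opp C) k Y Z Z' z') v; exists z.
Qed.

(** In the first variable a coresolution of any length preserves the bound [d]: the step passes to a
    higher degree for the cosyzygy, so the induction carries all [k] at once. *)
Lemma has_coresolution_ext_left (C : abelian) (P Q : set C) (n d : nat)
    (M L : C) :
  (forall W k, Q W -> (d <= k)%N -> ext_zero k.+1 W L) ->
  has_coresolution P Q n M -> forall k, (d <= k)%N -> ext_zero k.+1 M L.
Proof.
move=> vQ; elim: n M => [|n IHn] M.
  move=> /has_coresolution0[W [f [fiso _ QW]]] k le_dk.
  exact: ext_zero_iso_left fiso (vQ W k QW le_dk).
move=> /has_coresolutionS[W [K [i [p [s QW _ /IHn vK]]]]] k le_dk.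
by apply: (ext_zero_ses1_left s); [exact: vQ|apply: vK; apply: leqW].
Qed.

(** In the second variable each step lowers the degree by one, so the length enters the bound. *)
Lemma has_coresolution_ext_right (C : abelian) (P Q : set C) (n : nat)
    (M L : C) :
  (forall W k, Q W -> ext_zero k.+1 L W) ->
  has_coresolution P Q n M -> forall k, (n <= k)%N -> ext_zero k.+1 L M.
Proof.
move=> vQ; elim: n M => [|n IHn] M.
  move=> /has_coresolution0[W [f [fiso _ QW]]] k _.
  exact: ext_zero_iso fiso (vQ W k QW).
move=> /has_coresolutionS[W [K [i [p [s QW _ /IHn vK]]]]] [|k] // le_nk.
by apply: (ext_zero_ses1 s); [exact: vK|exact: vQ].
Qed.

Lemma has_resolution_opp (C : abelian) (P Q : set C) (n : nat) (M : C) :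
  @has_coresolution (opp C) P Q n M <-> has_resolution P Q n M.
Proof.
split=> [[O [f [[fm fex fe] [PQn QO imP]]]]|[O [f [[fm fex fe] [PQn QO imP]]]]];
  exists O, f; split; split=> // k hk.
- by apply: exact_opp_inv; apply: fex.
- by apply: image_opp_inv; apply: imP.
- by apply: exact_opp; apply: fex.
- by apply: image_opp; apply: imP.
Qed.

Lemma has_coresolution_opp (C : abelian) (P Q : set C) (n : nat) (M : C) :
  @has_resolution (opp C) P Q n M <-> has_coresolution P Q n M.
Proof.
split=> [[O [f [[fm fex fe] [PQn QO imP]]]]|[O [f [[fm fex fe] [PQn QO imP]]]]];
  exists O, f; split; split=> // k hk.
- by apply: exact_opp_inv; apply: fex.
- by apply: image_opp_inv; apply: imP.
- by apply: exact_opp; apply: fex.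
- by apply: image_opp; apply: imP.
Qed.

Lemma closed_summands_iso (C : abelian) (Z : set C) (M W : C) (f : Hom M W) :
  closed_summands Z -> is_iso f -> Z W -> Z M.
Proof.
move=> hZ [g [gf fg]]; have [O hO] := ab_zero C; apply: (hZ W M O).
exists f, 0, g, 0; split; rewrite ?comp0l ?comp0r ?addr0 //.
by rewrite [RHS](hO O).1.
Qed.

(** * Complete hereditary pairs *)

Section CompletePair.

Variables (C : abelian) (X A B : set C).
Hypotheses (hlcomplete : left_complete X A B) (hrcomplete : right_complete X A B).
Hypothesis hereditaryAB : forall M W k,
  (A `&` X) M -> (B `&` X) W -> ext_zero k.+1 M W.
Hypotheses (hAext : closed_extensions A) (hXext : closed_extensions X)
  (hXsum : closed_summands X) (hBsum : closed_summands B).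

Let omega := A `&` B `&` X.

Lemma ext1_vanishing_right (M : C) :
  X M -> (forall L, (A `&` X) L -> ext_zero 1 L M) -> B M.
Proof.
move=> /hrcomplete[K [L [f [g [/short_exactP s [BK _] aL]]]]] v.
exact: hBsum (ext1_split s (v L aL)) BK.
Qed.

Lemma kernel_in_omega (M W L : C) (i : Hom M W) (p : Hom W L) :
  ses i p -> (A `&` X) M -> (B `&` X) W -> (A `&` X) L -> omega W.
Proof.
by move=> /short_exactP s [AM _] [BW XW] [AL _]; split=> //; split=> //;
   apply: hAext s AM AL.
Qed.

Lemma has_coresolution_omega n (M : C) :
  (A `&` X) M -> (forall L, (A `&` X) L -> ext_zero n.+1 L M) ->
  has_coresolution X omega n M.
Proof.
elim: n M => [|n IHn] M aM v; have [AM XM] := aM.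
  apply/has_coresolution0; exists M, (idm M); split=> //.
    by exists (idm M); rewrite comp_idl.
  by split=> //; split=> //; apply: ext1_vanishing_right.
have [K [L [f [g [/short_exactP s bK aL]]]]] := hrcomplete XM.
apply/has_coresolutionS; exists K, L, f, g; split=> //.
- exact: kernel_in_omega s aM bK aL.
- by case: aL.
apply: IHn => // L' aL'; apply: (ext_zero_ses3 s); last exact: v.
exact: hereditaryAB.
Qed.

Lemma has_coresolution_right n (M : C) :
  X M -> (forall L, (A `&` X) L -> ext_zero n.+1 L M) ->
  has_coresolution X (B `&` X) n M.
Proof.
case: n => [|n] XM v.
  apply/has_coresolution0; exists M, (idm M); split=> //.
    by exists (idm M); rewrite comp_idl.
  by split=> //; apply: ext1_vanishing_right.
have [K [L [f [g [/short_exactP s bK aL]]]]] := hrcomplete XM.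
apply/has_coresolutionS; exists K, L, f, g; split=> //; first by case: aL.
(* [M] need not lie in [A], so the first term is only known to be in [B] and [X]; from the cosyzygy
   [L] on, the terms are in [omega]. *)
have h : has_coresolution X omega n L.
  apply: has_coresolution_omega => // L' aL'; apply: (ext_zero_ses3 s) (v L' aL').
  exact: hereditaryAB.
by apply: has_coresolution_mono h => // W [[]].
Qed.

(** The cosyzygies lie in [X], so each term is an extension of two objects of [X]. *)
Lemma has_coresolution_inX n (M : C) :
  X M -> has_coresolution X B n M -> has_coresolution X (B `&` X) n M.
Proof.
elim: n M => [|n IHn] M XM.
  move=> /has_coresolution0[W [f [fiso XW BW]]].
  by apply/has_coresolution0; exists W, f.
move=> /has_coresolutionS[W [K [i [p [s BW PK resK]]]]].
have XK : X K.
  case: n PK resK {IHn} => [_|n PK _]; last exact: PK.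
  by move=> /has_coresolution0[V [f [fiso XV _]]]; apply: closed_summands_iso fiso XV.
apply/has_coresolutionS; exists W, K, i, p; split=> //; last exact: IHn.
by split=> //; have /short_exactP s' := s; apply: hXext s' XM XK.
Qed.

(** Left completeness covers [L] by an object of [A] and [X] whose kernel is invisible to Ext by
    heredity; this removes [A] from the test class. *)
Lemma ext_vanishing_extend n :
  (forall M L k, (A `&` X) M -> (A `&` X) L -> (n <= k)%N -> ext_zero k.+1 M L) ->
  forall M L k, (A `&` X) M -> X L -> (n <= k)%N -> ext_zero k.+1 M L.
Proof.
move=> v M L k aM /hlcomplete[K [P [f [g [/short_exactP s aP bK]]]]] le_nk.
by apply: (ext_zero_ses3 s); [exact: v|exact: hereditaryAB].
Qed.

Lemma resolution_omega n (M : C) :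
  has_resolution setT omega n M ->
  forall L k, (A `&` X) L -> ext_zero k.+1 L M.
Proof.
move=> /has_resolution_opp res L k aL; apply/ext_zero_opp.
apply: (has_coresolution_ext_left (d := 0) _ res) => // W i [[AW BW] XW] _.
by apply/ext_zero_opp; apply: hereditaryAB.
Qed.

Lemma omega_has_resolution P (M : C) : omega M -> P M -> has_resolution P omega 0 M.
Proof.
move=> wM PM; apply/has_resolution_opp; apply/(@has_coresolution0 (opp C)).
exists M, (idm M); split=> //.
by exists (idm M); rewrite comp_idl.
Qed.

(** The inclusions [h1] to [h4] form a cycle through the four classes. *)
Lemma omega_equalities :
  omega = rperp (A `&` X) `&` A `&` X /\
  rperp (A `&` X) `&` A `&` X = A `&` X `&` wedge setT omega /\
  A `&` X `&` wedge setT omega = pair_wedge omega (A `&` X).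
Proof.
have h1 : omega `<=` pair_wedge omega (A `&` X).
  move=> M wM; have [[AM BM] XM] := wM; split=> //.
  by exists 0%N; apply: omega_has_resolution.
have h2 : pair_wedge omega (A `&` X) `<=` A `&` X `&` wedge setT omega.
  move=> M [[n res] [AM XM]]; split=> //; exists n; apply/has_resolution_opp.
  by have /has_resolution_opp := res; apply: has_coresolution_mono.
have h3 : A `&` X `&` wedge setT omega `<=` rperp (A `&` X) `&` A `&` X.
  move=> M [[AM XM] [n /resolution_omega v]]; split=> //; split=> //.
  by move=> W [|k] // aW _; apply: v.
have h4 : rperp (A `&` X) `&` A `&` X `<=` omega.
  move=> M [[v AM] XM]; split=> //; split=> //.
  by apply: ext1_vanishing_right => // L aL; apply: v.
split; [|split]; apply/seteqP; split.
- exact: subset_trans h1 (subset_trans h2 h3).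
- exact: h4.
- exact: subset_trans h4 (subset_trans h1 h2).
- exact: h3.
- exact: subset_trans h3 (subset_trans h4 h1).
- exact: h2.
Qed.

(** The common criterion for each of the eight dimensions to be at most [n]. *)
Let extdim n := forall M L k,
  (A `&` X) M -> (A `&` X) L -> (n <= k)%N -> ext_zero k.+1 M L.

Lemma extdim_projd n :
  le_enat (projd_class X (A `&` X)) (Fin n) <-> extdim n.
Proof.
rewrite projd_class_le; split=> [h M L k aM [_ XL]|]; first exact: h.
exact: ext_vanishing_extend.
Qed.

Lemma extdim_coresdim_omega n (M : C) :
  extdim n -> (A `&` X) M -> has_coresolution X omega n M.
Proof. by move=> h aM; apply: has_coresolution_omega => // L aL; apply: h. Qed.

Lemma extdim_coresdim n (M : C) :
  extdim n -> X M -> has_coresolution X (B `&` X) n M.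
Proof.
move=> h XM; apply: has_coresolution_right => // L aL.
exact: ext_vanishing_extend h _ _ _ aL XM (leqnn n).
Qed.

Lemma coresdim_extdim n :
  (forall M, (A `&` X) M -> exists m,
    (m <= n)%N /\ has_coresolution setT (B `&` X) m M) ->
  extdim n.
Proof.
move=> h M L k aM /h[m [le_mn res]] le_nk.
apply: (has_coresolution_ext_right _ res); last exact: leq_trans le_nk.
by move=> W i bW; apply: hereditaryAB.
Qed.

(** A sandwich: coresolutions of [A] ∩ [X] by [B] ∩ [X] are the weakest ones that force [extdim n],
    and every variant of (a1) lies between these and what [extdim n] produces. *)
Lemma coresdim_class_extdim (P Q D : set C) n :
  A `&` X `<=` D ->
  (forall m M, D M -> has_coresolution P Q m M ->
    has_coresolution setT (B `&` X) m M) ->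
  (extdim n -> forall M, D M -> has_coresolution P Q n M) ->
  le_enat (coresdim_class P Q D) (Fin n) <-> extdim n.
Proof.
move=> aD hQ hn; rewrite coresdim_class_le; split=> [h|/hn h M DM]; last first.
  by exists n; split=> //; apply: h.
apply: coresdim_extdim => M aM; have [m [le_mn res]] := h M (aD _ aM).
by exists m; split=> //; apply: hQ res; apply: aD.
Qed.

Lemma dimension_equalities :
  projd_class X (A `&` X) = projd_class (A `&` X) (A `&` X) /\
  projd_class (A `&` X) (A `&` X) = coresdim_class setT (B `&` X) (A `&` X) /\
  coresdim_class setT (B `&` X) (A `&` X) = coresdim_class X B X /\
  coresdim_class X B X = coresdim_class X B (A `&` X) /\
  coresdim_class X B (A `&` X) = coresdim_class setT omega (A `&` X) /\
  coresdim_class setT omega (A `&` X)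
    = coresdim_class X (B `&` X) (A `&` X) /\
  coresdim_class X (B `&` X) (A `&` X) = coresdim_class X (B `&` X) X.
Proof.
have aX : A `&` X `<=` X by move=> M [].
have bB : B `&` X `<=` B by move=> M [].
have wb : omega `<=` B `&` X by move=> M [[]].
have XBb m M : X M -> has_coresolution X B m M ->
    has_coresolution setT (B `&` X) m M.
  by move=> XM /(has_coresolution_inX XM); apply: has_coresolution_mono.
have Xb m M : has_coresolution X (B `&` X) m M ->
    has_coresolution setT (B `&` X) m M by exact: has_coresolution_mono.
have t1 n := extdim_projd n.
have t2 n : le_enat (projd_class (A `&` X) (A `&` X)) (Fin n) <-> extdim n.
  exact: projd_class_le.
have t3 n : le_enat (coresdim_class setT (B `&` X) (A `&` X)) (Fin n) <-> extdim n.
  apply: coresdim_class_extdim => // h M /aX XM.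
  by apply: Xb; apply: extdim_coresdim.
have t4 n : le_enat (coresdim_class X B X) (Fin n) <-> extdim n.
  apply: coresdim_class_extdim => // h M XM.
  by apply: has_coresolution_mono (extdim_coresdim h XM).
have t5 n : le_enat (coresdim_class X B (A `&` X)) (Fin n) <-> extdim n.
  apply: coresdim_class_extdim => // [m M /aX|h M /aX XM]; first exact: XBb.
  by apply: has_coresolution_mono (extdim_coresdim h XM).
have t6 n : le_enat (coresdim_class setT omega (A `&` X)) (Fin n) <-> extdim n.
  apply: coresdim_class_extdim => // [m M _|h M aM].
    exact: has_coresolution_mono.
  by apply: has_coresolution_mono (extdim_coresdim_omega h aM).
have t7 n : le_enat (coresdim_class X (B `&` X) (A `&` X)) (Fin n) <-> extdim n.
  apply: coresdim_class_extdim => // [m M _|h M /aX]; first exact: Xb.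
  exact: extdim_coresdim.
have t8 n : le_enat (coresdim_class X (B `&` X) X) (Fin n) <-> extdim n.
  by apply: coresdim_class_extdim => // [m M _|h M]; [exact: Xb|exact: extdim_coresdim].
by do ![split]; apply: enat_eqP => n; rewrite ?t1 ?t2 ?t3 ?t4 ?t5 ?t6 ?t7 ?t8.
Qed.

Lemma projd_omega_le n :
  A `&` X `<=` vee setT omega -> le_enat (projd_class X omega) (Fin n) ->
  le_enat (projd_class X (A `&` X)) (Fin n).
Proof.
move=> aw /projd_class_le h; apply/projd_class_le => M L k /aw[m res] XL.
by move: k; apply: has_coresolution_ext_left res => W k wW; apply: h.
Qed.

Lemma finite_dimension :
  (projd_class (A `&` X) (A `&` X) <> Infty <->
    A `&` X `<=` vee setT omega /\ projd_class X omega <> Infty) /\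
  (projd_class (A `&` X) (A `&` X) <> Infty ->
    X `<=` pair_vee X B /\
    pair_vee X B `<=` vee setT (B `&` X) /\
    projd_class X (A `&` X) = projd_class X omega).
Proof.
(* Finiteness is now about [projd_class X (A ∩ X)], with the same test class [X] as for [omega]. *)
have [<- _] := dimension_equalities.
have wa : omega `<=` A `&` X by move=> M [[]].
have h1 n : le_enat (projd_class X (A `&` X)) (Fin n) ->
    le_enat (projd_class X omega) (Fin n).
  by move=> /projd_class_le h; apply/projd_class_le => M L k /wa; apply: h.
have h2 : projd_class X (A `&` X) <> Infty -> A `&` X `<=` vee setT omega.
  move=> /neq_Infty[n /extdim_projd h] M aM; exists n.
  by apply: has_coresolution_mono (extdim_coresdim_omega h aM).
split.
  split=> [fin|[aw /neq_Infty[n h]]].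
    split; first exact: h2.
    by have /neq_Infty[n /h1 h] := fin; apply/neq_Infty; exists n.
  by apply/neq_Infty; exists n; apply: projd_omega_le.
move=> fin; split; [|split].
- move=> M XM; split=> //; have /neq_Infty[n /extdim_projd h] := fin.
  by exists n; apply: has_coresolution_mono (extdim_coresdim h XM) => // W [].
- move=> M [XM [n /(has_coresolution_inX XM) res]]; exists n.
  exact: has_coresolution_mono res.
apply: enat_eqP => n; split; first exact: h1.
by apply: projd_omega_le; apply: h2.
Qed.

End CompletePair.

(** * Translation of the relative notions to the opposite category *)

Lemma rperp_opp (C : abelian) (Z : set C) : @rperp (opp C) Z = lperp Z.
Proof.
by apply/seteqP; split=> M h W i ZW i1; apply/ext_zero_opp; apply: h.
Qed.

Lemma vee_opp (C : abelian) (P Q : set C) : @vee (opp C) P Q = wedge P Q.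
Proof.
by apply/seteqP; split=> M [n /has_resolution_opp h]; exists n.
Qed.

Lemma wedge_opp (C : abelian) (P Q : set C) : @wedge (opp C) P Q = vee P Q.
Proof.
by apply/seteqP; split=> M [n /has_coresolution_opp h]; exists n.
Qed.

Lemma projd_class_opp (C : abelian) (Z D : set C) :
  @projd_class (opp C) Z D = injd_class Z D.
Proof.
apply: enat_eqP => n; rewrite injd_class_le (@projd_class_le (opp C)).
by split=> h M W k DM ZW le_nk; apply/ext_zero_opp; apply: h.
Qed.

Lemma coresdim_class_opp (C : abelian) (P Q D : set C) :
  @coresdim_class (opp C) P Q D = resdim_class P Q D.
Proof.
apply: enat_eqP => n; rewrite (@coresdim_class_le (opp C)) sup_enat_le.
split=> h M /h; last by move=> /min_enat_le[m [le_mn /has_resolution_opp]]; exists m.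
by move=> [m [le_mn /has_resolution_opp]] res; apply/min_enat_le; exists m.
Qed.

Lemma short_exact_opp (C : abelian) (X Y Z : C) (f : Hom X Y) (g : Hom Y Z) :
  short_exact f g -> @short_exact (opp C) Z Y X g f.
Proof. by move=> /short_exactP/opp_ses/(short_exactP (C := opp C)). Qed.

Lemma short_exact_opp_inv (C : abelian) (X Y Z : C) (f : Hom X Y)
    (g : Hom Y Z) :
  @short_exact (opp C) Z Y X g f -> short_exact f g.
Proof. by move=> /short_exactP/opp_ses_inv/short_exactP. Qed.

Lemma closed_extensions_opp (C : abelian) (Z : set C) :
  closed_extensions Z -> @closed_extensions (opp C) Z.
Proof. by move=> h L M N f g /short_exact_opp_inv/h ? ? ?; auto. Qed.

Lemma closed_summands_opp (C : abelian) (Z : set C) :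
  closed_summands Z -> @closed_summands (opp C) Z.
Proof.
move=> h S M N [i1 [i2 [p1 [p2 [? ? ? ? ?]]]]]; apply: (h S M N).
by exists p1, p2, i1, i2; split.
Qed.

Lemma left_complete_opp (C : abelian) (X A B : set C) :
  right_complete X A B -> @left_complete (opp C) X B A.
Proof.
move=> h M /h[K [L [f [g [s bK aL]]]]]; exists L, K, g, f; split=> //.
exact: short_exact_opp.
Qed.

Lemma right_complete_opp (C : abelian) (X A B : set C) :
  left_complete X A B -> @right_complete (opp C) X B A.
Proof.
move=> h M /h[K [L [f [g [s aL bK]]]]]; exists L, K, g, f; split=> //.
exact: short_exact_opp.
Qed.

End AbelianCategories.

Theorem theorem4p24 (C : abelian) (X A B : set C)
    (hcomplete : complete X A B) (hhereditary : hereditary X A B)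
    (hAext : closed_extensions A) (hAsum : closed_summands A)
    (hXext : closed_extensions X) (hXsum : closed_summands X)
    (hBext : closed_extensions B) (hBsum : closed_summands B) :
  let omega := A `&` B `&` X in
  (* (a) *)
  (omega = rperp (A `&` X) `&` A `&` X /\
   rperp (A `&` X) `&` A `&` X = A `&` X `&` wedge setT omega /\
   A `&` X `&` wedge setT omega = pair_wedge omega (A `&` X)) /\
  (* (a1) *)
  (projd_class X (A `&` X) = projd_class (A `&` X) (A `&` X) /\
   projd_class (A `&` X) (A `&` X) = coresdim_class setT (B `&` X) (A `&` X) /\
   coresdim_class setT (B `&` X) (A `&` X) = coresdim_class X B X /\
   coresdim_class X B X = coresdim_class X B (A `&` X) /\
   coresdim_class X B (A `&` X) = coresdim_class setT omega (A `&` X) /\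
   coresdim_class setT omega (A `&` X)
     = coresdim_class X (B `&` X) (A `&` X) /\
   coresdim_class X (B `&` X) (A `&` X) = coresdim_class X (B `&` X) X) /\
  (* (a2) *)
  ((projd_class (A `&` X) (A `&` X) <> Infty <->
    A `&` X `<=` vee setT omega /\ projd_class X omega <> Infty) /\
   (projd_class (A `&` X) (A `&` X) <> Infty ->
    X `<=` pair_vee X B /\
    pair_vee X B `<=` vee setT (B `&` X) /\
    projd_class X (A `&` X) = projd_class X omega)) /\
  (* (b) *)
  (omega = lperp (B `&` X) `&` B `&` X /\
   lperp (B `&` X) `&` B `&` X = B `&` X `&` vee setT omega /\
   B `&` X `&` vee setT omega = pair_vee (B `&` X) omega) /\
  (* (b1) *)
  (injd_class X (B `&` X) = injd_class (B `&` X) (B `&` X) /\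
   injd_class (B `&` X) (B `&` X) = resdim_class setT (A `&` X) (B `&` X) /\
   resdim_class setT (A `&` X) (B `&` X) = resdim_class X A X /\
   resdim_class X A X = resdim_class X A (B `&` X) /\
   resdim_class X A (B `&` X) = resdim_class setT omega (B `&` X) /\
   resdim_class setT omega (B `&` X)
     = resdim_class X (A `&` X) (B `&` X) /\
   resdim_class X (A `&` X) (B `&` X) = resdim_class X (A `&` X) X) /\
  (* (b2) *)
  ((injd_class (B `&` X) (B `&` X) <> Infty <->
    B `&` X `<=` wedge setT omega /\ injd_class X omega <> Infty) /\
   (injd_class (B `&` X) (B `&` X) <> Infty ->
    X `<=` pair_wedge A X /\
    pair_wedge A X `<=` wedge setT (A `&` X) /\
    injd_class X (B `&` X) = injd_class X omega)).
Proof.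
have [lc rc] := hcomplete.
have her M W k : (A `&` X) M -> (B `&` X) W -> ext_zero k.+1 M W.
  move=> aM bW; have /injd_class_le h : le_enat (injd_class (A `&` X) (B `&` X)) (Fin 0).
    by rewrite hhereditary.
  exact: h.
have her' (M W : opp C) k :
    (B `&` X) M -> (A `&` X) W -> @ext_zero (opp C) k.+1 M W.
  by move=> bM aW; apply/ext_zero_opp; apply: her.
have lc' := left_complete_opp rc.
have rc' := right_complete_opp lc.
have Bext' := closed_extensions_opp hBext.
have Xext' := closed_extensions_opp hXext.
have Asum' := closed_summands_opp hAsum.
have Xsum' := closed_summands_opp hXsum.
move=> omega.
(* In [opp C] the pair is [B], [A], so its [omega] appears with the factors exchanged. *)
have omegaC : B `&` A `&` X = omega by rewrite (setIC B).
have := omega_equalities rc' her' Asum'.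
have := dimension_equalities lc' rc' her' Bext' Xext' Xsum' Asum'.
have := finite_dimension lc' rc' her' Bext' Xext' Xsum' Asum'.
rewrite /pair_vee /pair_wedge omegaC.
rewrite !projd_class_opp !coresdim_class_opp !vee_opp !wedge_opp rperp_opp.
move=> b2 b1 b.
have a := omega_equalities rc her hBsum.
have a1 := dimension_equalities lc rc her hAext hXext hXsum hBsum.
have a2 := finite_dimension lc rc her hAext hXext hXsum hBsum.
split; first exact: a.
split; first exact: a1.
split; first exact: a2.
(* [pair_vee] and [pair_wedge] list their factors in opposite orders, so the dual statement is
   matched up to commutativity of the intersection. *)
split; first by rewrite /pair_vee [X in _ /\ _ /\ _ = X]setIC; exact: b.
split; first exact: b1.
by rewrite /pair_wedge [wedge X A `&` X]setIC; exact: b2.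
Qed.
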